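(* The $k$-Sink Location problem is $W[1]$-hard when parameterized by $k$.
   Context: A dynamic network $\mathcal{N}=(G,c,\tau,S)$ consists of a graph $G=(V,E)$, a capacity $c(e)\in\mathbb{N}$ and a transit time $\tau(e)\in\mathbb{N}^+$ for each edge $e$, and a set $S\subseteq V$ of sources, each $u\in S$ having a supply $\sigma(u)\in\mathbb{N}$. A position is a point on an edge $uv$ at integer travel times $\tau(ux),\tau(xv)\ge 0$ from $u$ and $v$ with $\tau(ux)+\tau(xv)=\tau(uv)$ (vertices are positions). Supply is routed as a flow over time: flow enters an edge $e$ (in either direction for undirected $G$) at rate at most $c(e)$ per unit time and arrives at the other end after $\tau(e)$ time units. The $k$-Sink Location problem (decision form, with parameter $k$): given $(\mathcal{N},\sigma)$, $k$ and a time bound $T$, decide whether there exist $k$ positions in $G$ such that all supply can be routed to these positions by time $T$. *)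

(* Defs.v *)
From mathcomp Require Import all_boot all_order all_algebra.
From mathcomp Require Import reals.

Set Implicit Arguments.
Unset Strict Implicit.
Unset Printing Implicit Defensive.

Import Order.TTheory GRing.Theory Num.Theory.

(* Uniform-cost random access machines with addition, truncated subtraction and
   halving (and no multiplication), presented as structured programs. The
   memory is a family of banks of cells; a program names its banks statically
   and computes addresses. A step lengthens the binary contents of a cell by
   O(1) digits only, so running times agree with those of Turing machines up to
   a polynomial. *)

Inductive expr :=
  | Cst of nat
  | Cell of nat & expr
  | Add of expr & expr
  | Sub of expr & expr
  | Half of expr.

Inductive prog :=
  | Skip
  | Assign of nat & expr & expr
  | Seq of prog & prog
  | If of expr & prog & prog
  | While of expr & prog.

Definition state := nat -> nat -> nat.

Fixpoint value (s : state) (e : expr) : nat :=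
  match e with
  | Cst n => n
  | Cell b e1 => s b (value s e1)
  | Add e1 e2 => value s e1 + value s e2
  | Sub e1 e2 => value s e1 - value s e2
  | Half e1 => (value s e1)./2
  end.

Definition update (s : state) (b i v : nat) : state :=
  fun b' i' => if (b' == b) && (i' == i) then v else s b' i'.

(* [exec p s t s']: started in s, p halts in s' after t steps; the size of an
   expression is a constant of the program, so its evaluation is one step. *)
Inductive exec : prog -> state -> nat -> state -> Prop :=
  | ExecSkip s : exec Skip s 1 s
  | ExecAssign b i e s :
      exec (Assign b i e) s 1 (update s b (value s i) (value s e))
  | ExecSeq p q s1 s2 s3 t1 t2 :
      exec p s1 t1 s2 -> exec q s2 t2 s3 -> exec (Seq p q) s1 (t1 + t2) s3
  | ExecIfTrue e p q s t s' :
      value s e != 0 -> exec p s t s' -> exec (If e p q) s t.+1 s'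
  | ExecIfFalse e p q s t s' :
      value s e = 0 -> exec q s t s' -> exec (If e p q) s t.+1 s'
  | ExecWhileTrue e p s1 s2 s3 t1 t2 :
      value s1 e != 0 -> exec p s1 t1 s2 -> exec (While e p) s2 t2 s3 ->
      exec (While e p) s1 (t1 + t2).+1 s3
  | ExecWhileFalse e p s :
      value s e = 0 -> exec (While e p) s 1 s.

(* Input and output are words, i.e. finite sequences of naturals, stored in
   bank 0 from address 1 on, with their length at address 0. *)
Definition init (w : seq nat) : state :=
  fun b i => if b == 0 then nth 0 (size w :: w) i else 0.

Definition result (w : seq nat) (s : state) : Prop :=
  forall i, i <= size w -> s 0 i = nth 0 (size w :: w) i.

Definition computes (p : prog) (w : seq nat) (t : nat) (w' : seq nat) : Prop :=
  exists2 s, exec p (init w) t s & result w' s.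

Definition computable (f : nat -> nat) : Prop :=
  exists p, forall n, exists t, computes p [:: n] t [:: f n].

(* [L x k]: the instance x with parameter k is a yes-instance. *)
Definition parameterized_problem := seq nat -> nat -> Prop.

(* Total number of binary digits of the word, which is its length as a string
   over a finite alphabet up to a constant factor (for the separators). *)
Definition bitsize (x : seq nat) : nat := \sum_(a <- x) (trunc_log 2 a).+1.

(* The length of the output is charged on top of the running time: otherwise a
   program could announce an exponential length and leave the cells at 0. *)
Definition fpt_reducible (L L' : parameterized_problem) : Prop :=
  exists (p : prog) (f g : nat -> nat) (c : nat),
    [/\ computable f, computable g
      & forall x k, exists x' k' t,
        [/\ computes p (k :: x) t (k' :: x'),
            t + size x' <= f k * (bitsize x).+1 ^ c,
            k' <= g k
          & L x k <-> L' x' k']].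

(* A circuit is the list of its nodes in a topological order: a gate refers to
   its predecessors by their indices. The last node is the output. *)
Inductive gate :=
  | Input
  | Not of nat
  | And of seq nat
  | Or of seq nat.

Definition circuit := seq gate.

Definition preds (g : gate) : seq nat :=
  match g with Input => [::] | Not i => [:: i] | And s => s | Or s => s end.

Definition wf_gate (j : nat) (g : gate) : bool :=
  [&& all (fun i => i < j) (preds g), uniq (preds g)
    & if g is Input then true else preds g != [::]].

Definition wf_circuit (C : circuit) : bool :=
  (0 < size C) && [forall j : 'I_(size C), wf_gate j (nth Input C j)].

(* Node labels computed along the topological order; F gets the index of the
   node, the labels of the previous nodes, and the gate. *)
Definition labels (A : Type) (F : nat -> seq A -> gate -> A) (C : circuit) :
    seq A :=
  foldl (fun vs g => rcons vs (F (size vs) vs g)) [::] C.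

(* The assignment a is only consulted at the indices of the input nodes. *)
Definition gate_value (a : nat -> bool) (j : nat) (vs : seq bool) (g : gate) :
    bool :=
  match g with
  | Input => a j
  | Not i => ~~ nth false vs i
  | And s => all (nth false vs) s
  | Or s => has (nth false vs) s
  end.

Definition satisfies (C : circuit) (a : nat -> bool) : bool :=
  last false (labels (gate_value a) C).

Definition weight (C : circuit) (a : nat -> bool) : nat :=
  \sum_(j < size C) (if nth (Or [::]) C j is Input then a j : nat else 0).

Definition gate_depth (j : nat) (vs : seq nat) (g : gate) : nat :=
  if g is Input then 0 else (\max_(i <- preds g) nth 0 vs i).+1.

(* Depth and weft are the maximal numbers of edges, resp. of nodes of fan-in
   larger than 2, on a path from an input node to the output. *)
Definition depth (C : circuit) : nat := last 0 (labels gate_depth C).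

Definition gate_weft (j : nat) (vs : seq nat) (g : gate) : nat :=
  (2 < size (preds g)) + \max_(i <- preds g) nth 0 vs i.

Definition weft (C : circuit) : nat := last 0 (labels gate_weft C).

Definition encode_gate (g : gate) : seq nat :=
  (match g with Input => 0 | Not _ => 1 | And _ => 2 | Or _ => 3 end)
    :: size (preds g) :: preds g.

Definition encode_circuit (C : circuit) : seq nat :=
  size C :: flatten (map encode_gate C).

Definition WCS (t d : nat) : parameterized_problem := fun x k =>
  exists C : circuit,
    [/\ x = encode_circuit C, wf_circuit C, weft C <= t, depth C <= d
      & exists2 a, satisfies C a & weight C a = k].

Definition W (t : nat) (L : parameterized_problem) : Prop :=
  exists d, fpt_reducible L (WCS t d).

Definition W_hard (t : nat) (Q : parameterized_problem) : Prop :=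
  forall L, W t L -> fpt_reducible L Q.

(* In an undirected network, the edge uv is listed once, with u and v as tail
   and head in either order. *)
Record edge := Edge { tail : nat; head : nat; cap : nat; time : nat }.

(* The vertices are 0, ..., size (supply N) - 1; entry u of [supply N] is
   [Some s] if u is a source of supply s, and [None] if u is not a source. *)
Record network := Network { supply : seq (option nat); edges : seq edge }.

Definition edge0 := Edge 0 0 0 0.

Definition order (N : network) : nat := size (supply N).

Definition endpoints (directed : bool) (e : edge) : nat * nat :=
  if directed then (tail e, head e)
  else (minn (tail e) (head e), maxn (tail e) (head e)).

Definition wf_edge (n : nat) (e : edge) : bool :=
  [&& tail e < n, head e < n, tail e != head e & 0 < time e].

Definition wf_network (directed : bool) (N : network) : bool :=
  all (wf_edge (order N)) (edges N)
  && uniq (map (endpoints directed) (edges N)).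

(* [inl u] is the vertex u; [inr (j, i)] is the point in the interior of edge j
   at travel time i from its tail. *)
Definition position := (nat + nat * nat)%type.

Definition is_position (N : network) (p : position) : bool :=
  match p with
  | inl u => u < order N
  | inr (j, i) => (j < size (edges N)) && (0 < i < time (nth edge0 (edges N) j))
  end.

Definition point (N : network) (j i : nat) : position :=
  let e := nth edge0 (edges N) j in
  if i == 0 then inl (tail e)
  else if i == time e then inl (head e) else inr (j, i).

Definition supply_at (N : network) (p : position) : nat :=
  if p is inl u then odflt 0 (nth None (supply N) u) else 0.

Definition total_supply (N : network) : nat :=
  \sum_(u < order N) supply_at N (inl (u : nat)).

Record arc := Arc { src : position; dst : position; acap : nat; atime : nat }.

(* Travel times from the tail of edge j of its ends and of the sinks of X lying
   in its interior, in increasing order. *)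
Definition stops (N : network) (X : seq position) (j : nat) : seq nat :=
  let e := nth edge0 (edges N) j in
  [seq i <- iota 0 (time e).+1
     | [|| i == 0, i == time e | (inr (j, i) : position) \in X]].

(* Edge j, subdivided at the sinks in its interior; an undirected edge can be
   entered in either direction, hence gives two opposite arcs. *)
Definition edge_arcs (directed : bool) (N : network) (X : seq position)
    (j : nat) : seq arc :=
  let e := nth edge0 (edges N) j in
  let st := stops N X j in
  flatten [seq
    let forward := Arc (point N j ab.1) (point N j ab.2) (cap e) (ab.2 - ab.1) in
    let backward := Arc (point N j ab.2) (point N j ab.1) (cap e) (ab.2 - ab.1) in
    if directed then [:: forward] else [:: forward; backward]
    | ab <- zip st (behead st)].

Definition arcs (directed : bool) (N : network) (X : seq position) : seq arc :=
  flatten [seq edge_arcs directed N X j | j <- iota 0 (size (edges N))].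

Section FlowOverTime.
Variables (R : realType) (directed : bool) (N : network) (X : seq position).

Local Open Scope ring_scope.

Let A := arcs directed N X.
Let arc_of (a : 'I_(size A)) : arc := tnth (in_tuple A) a.

(* A flow over time is given by its cumulative inflows: [F a t] is the amount
   that has entered the arc a by time t. The inflow rate being at most c means
   that at most c * (t - s) enters between the times s and t, see
   [flow_over_time]. *)
Definition flow := 'I_(size A) -> R -> R.

(* The amount lying at p at time t: what was there initially or has arrived by
   then, minus what has left. *)
Definition stock (F : flow) (p : position) (t : R) : R :=
  (supply_at N p)%:R
  + \sum_(a | dst (arc_of a) == p) F a (t - (atime (arc_of a))%:R)
  - \sum_(a | src (arc_of a) == p) F a t.

Definition flow_over_time (F : flow) : Prop :=
  [/\ forall a t, t <= 0 -> F a t = 0,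
      forall a s t, s <= t -> 0 <= F a t - F a s <= (acap (arc_of a))%:R * (t - s)
    & forall p t, 0 <= stock F p t].

(* All the supply lies at the sinks at time T. *)
Definition routable (T : nat) : Prop :=
  exists2 F, flow_over_time F
    & \sum_(x <- X) stock F x T%:R = (total_supply N)%:R.

End FlowOverTime.

Definition encode_supply (s : option nat) : nat := if s is Some m then m.+1 else 0.

Definition encode_edge (e : edge) : seq nat :=
  [:: tail e; head e; cap e; time e].

Definition encode_network (N : network) (T : nat) : seq nat :=
  [:: T, order N, size (edges N)
    & map encode_supply (supply N) ++ flatten (map encode_edge (edges N))].

Definition k_sink_location (R : realType) (directed : bool) :
    parameterized_problem := fun x k =>
  exists (N : network) (T : nat),
    [/\ x = encode_network N T, wf_network directed N
      & exists X : seq position,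
          [/\ uniq X, size X = k, all (is_position N) X
            & routable R directed N X T]].

(* Main.v *)
(** A weft-1 circuit of depth d is turned into a covering problem, which is a
    sink location problem with unit capacities and transit times and T = 2:
    a unit supply then moves along at most one edge, so that the supply can be
    routed if and only if every source is a sink or has an edge into a sink.

    The sinks are forced to form one choice "group g chooses node c" for each
    of k + O(1) groups. The first k groups choose the inputs set to true. Unroll
    the circuit from its output into the evaluation game, negations pushed to the
    inputs: the universal player picks the conjuncts, and its strategies, written
    as vectors y of a bounded number of digits, are the sources. A disjunction of
    two gates is kept inside a source, which is covered as soon as one of the two
    sides is; the witness of a disjunction of large fan-in is chosen by one of the
    further groups. As the weft is 1, nothing large lies below such a gate, so its
    position in the unrolled tree determines it and O(1) groups are enough.

    Whether x encodes a circuit of weft 1 and depth d is also a conjunction of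
    conditions on boundedly many digits; they are added to the sources, so that
    invalid words become no-instances. The covering relation is then the value of
    a single expression of the machine, evaluated in nested loops. *)
From HB Require Import structures.
From mathcomp Require Import all_boot all_order all_algebra.
From mathcomp Require Import reals zify lra.
Require Import Defs.

Set Implicit Arguments.
Unset Strict Implicit.
Unset Printing Implicit Defensive.

(** * Running times of programs *)

(** A source is covered by the choice of a single group, so a condition that links several choices
    has to be split up. Here the strategy y guesses: at a disjunction of large fan-in one digit
    guesses the witness, a wrong guess is covered by the witness group itself, and only the right
    guess plays on. Likewise, that an input is false is expressed by a digit naming a group, which
    has to choose another node. The main obstacle is the order of choices, as the sinks are fixed
    before y is known. A witness may depend on the position in the tree, but not on the digits read
    on the way to it. Hence the two children of a gate own separate positions, and a large
    conjunction above a large disjunction would break the argument. The machine shapes the rest. It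
    cannot multiply, so powers arise as numbers of loop rounds, and loop counters serve as digits.
    An expression costs one step whatever its size, and d is fixed before the program, so the whole
    game can be unrolled inside an expression. *)

Definition wp (n : nat) (p : prog) (s : state) (Q : state -> Prop) : Prop :=
  exists t s', [/\ exec p s t s', t <= n & Q s'].

Lemma wp_weaken n n' p s (Q Q' : state -> Prop) :
  n <= n' -> (forall s', Q s' -> Q' s') -> wp n p s Q -> wp n' p s Q'.
Proof.
move=> le_n QQ' [t [s' [e le_t Qs']]].
by exists t, s'; split=> //; [exact: leq_trans le_t le_n | exact: QQ'].
Qed.

Lemma wp_skip s (Q : state -> Prop) : Q s -> wp 1 Skip s Q.
Proof. by move=> Qs; exists 1, s; split=> //; constructor. Qed.

Lemma wp_assign b i e s (Q : state -> Prop) :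
  Q (update s b (value s i) (value s e)) -> wp 1 (Assign b i e) s Q.
Proof. by move=> Qs; eexists; eexists; split; [constructor| |exact: Qs]. Qed.

Lemma wp_seq n1 n2 p q s (Q : state -> Prop) :
  wp n1 p s (fun s' => wp n2 q s' Q) -> wp (n1 + n2) (Seq p q) s Q.
Proof.
move=> [t1 [s1 [e1 le1 [t2 [s2 [e2 le2 Qs2]]]]]].
by exists (t1 + t2), s2; split; [exact: ExecSeq e1 e2 | exact: leq_add |].
Qed.

Lemma wp_if n e p q s (Q : state -> Prop) :
  (value s e != 0 -> wp n p s Q) -> (value s e = 0 -> wp n q s Q) ->
  wp n.+1 (If e p q) s Q.
Proof.
move=> H1 H0; have [e0|e1] := eqVneq (value s e) 0.
  have [t [s' [ex le_t Qs]]] := H0 e0.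
  by exists t.+1, s'; split=> //; apply: ExecIfFalse.
have [t [s' [ex le_t Qs]]] := H1 e1.
by exists t.+1, s'; split=> //; apply: ExecIfTrue.
Qed.

(** The index of [I] is the number of rounds still allowed. It drops in every round, so the loop has
    stopped by the time it is 0. A round costs one step more than its body, for the test. *)
Lemma wp_while (I : nat -> state -> Prop) e p n N s (Q : state -> Prop) :
  (forall j s, I j s -> value s e != 0 ->
     exists2 j', j = j'.+1 & wp n p s (I j')) ->
  (forall j s, I j s -> value s e = 0 -> Q s) ->
  I N s -> wp (N * n.+1).+1 (While e p) s Q.
Proof.
move=> step stop; elim: N s => [|N IH] s Is.
  have [e0|e1] := eqVneq (value s e) 0.
    by exists 1, s; split=> //; [exact: ExecWhileFalse | exact: stop Is e0].
  by have [j'] := step _ _ Is e1.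
have [e0|e1] := eqVneq (value s e) 0.
  by exists 1, s; split=> //; [exact: ExecWhileFalse | exact: stop Is e0].
have [_ [<-] [t1 [s1 [ex1 le1 /IH [t2 [s2 [ex2 le2 Qs2]]]]]]] := step _ _ Is e1.
exists (t1 + t2).+1, s2; split=> //; first exact: ExecWhileTrue e1 ex1 ex2.
by rewrite ltnS mulSn; lia.
Qed.

Definition For (b i : nat) (e : expr) (p : prog) : prog :=
  Seq (Assign b (Cst i) (Cst 0))
      (While (Sub e (Cell b (Cst i)))
             (Seq p (Assign b (Cst i) (Add (Cell b (Cst i)) (Cst 1))))).

Lemma updateE s b i v b' i' :
  update s b i v b' i' = if (b' == b) && (i' == i) then v else s b' i'.
Proof. by []. Qed.

Lemma wp_for (I : nat -> state -> Prop) b i e p n N s :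
  (forall j s, j <= N -> s b i = j -> I j s -> value s e = N) ->
  (forall j s, j < N -> s b i = j -> I j s ->
     wp n p s (fun s' => s' b i = j /\ I j.+1 (update s' b i j.+1))) ->
  I 0 (update s b i 0) ->
  wp (N * n.+2 + 2) (For b i e p) s (fun s' => s' b i = N /\ I N s').
Proof.
move=> bound step I0.
have -> : N * n.+2 + 2 = 1 + (N * n.+2).+1 by lia.
apply/wp_seq/wp_assign => /=.
apply: (@wp_while (fun j s => [/\ j <= N, s b i = N - j & I (N - j) s])).
- move=> j s' [jN sj Ij] /=; rewrite (bound (N - j) s') ?leq_subr // sj subKn //.
  case: j => [|j] // in jN sj Ij *.
  exists j => //; rewrite -addn1; apply/wp_seq.
  apply: wp_weaken (step (N - j.+1) s' _ sj Ij) => //; last by lia.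
  move=> s1 [s1j Is1]; apply: wp_assign => /=.
  have <- : (N - j.+1).+1 = N - j by lia.
  rewrite s1j addn1; split=> //; first by lia.
  by rewrite updateE !eqxx.
- move=> j s' [jN sj Ij] /=.
  rewrite (bound (N - j) s') ?leq_subr // sj subKn // => j0.
  by move: sj Ij; rewrite j0 subn0 => sj Ij; split.
- by split; rewrite ?subnn // updateE !eqxx.
Qed.

(** * Relocation and composition of programs *)

Fixpoint banks_expr (e : expr) : nat :=
  match e with
  | Cst _ => 0
  | Cell b e1 => maxn b.+1 (banks_expr e1)
  | Add e1 e2 | Sub e1 e2 => maxn (banks_expr e1) (banks_expr e2)
  | Half e1 => banks_expr e1
  end.

(** Only banks that are written count: from this number on all banks keep their initial contents,
    whatever the program reads. *)
Fixpoint banks (p : prog) : nat :=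
  match p with
  | Skip => 0
  | Assign b _ _ => b.+1
  | Seq p q | If _ p q => maxn (banks p) (banks q)
  | While _ p => banks p
  end.

Lemma exec_frame p s t s' :
  exec p s t s' -> forall b i, banks p <= b -> s' b i = s b i.
Proof.
elim=> //= {p s t s'}.
- by move=> b i e s b' i' lt_b; rewrite updateE gtn_eqF.
- move=> p q s1 s2 s3 t1 t2 _ IH1 _ IH2 b i; rewrite geq_max => /andP[pb qb].
  by rewrite IH2 ?IH1.
- by move=> e p q s t s' _ _ IH b i; rewrite geq_max => /andP[pb qb]; apply: IH.
- by move=> e p q s t s' _ _ IH b i; rewrite geq_max => /andP[pb qb]; apply: IH.
- by move=> e p s1 s2 s3 t1 t2 _ _ IH1 _ IH2 b i pb; rewrite IH2 ?IH1.
Qed.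

Fixpoint shift_expr (M : nat) (e : expr) : expr :=
  match e with
  | Cst n => Cst n
  | Cell b e1 => Cell (M + b) (shift_expr M e1)
  | Add e1 e2 => Add (shift_expr M e1) (shift_expr M e2)
  | Sub e1 e2 => Sub (shift_expr M e1) (shift_expr M e2)
  | Half e1 => Half (shift_expr M e1)
  end.

Fixpoint shift (M : nat) (p : prog) : prog :=
  match p with
  | Skip => Skip
  | Assign b i e => Assign (M + b) (shift_expr M i) (shift_expr M e)
  | Seq p q => Seq (shift M p) (shift M q)
  | If e p q => If (shift_expr M e) (shift M p) (shift M q)
  | While e p => While (shift_expr M e) (shift M p)
  end.

Lemma value_shift M e (s S : state) :
  (forall b i, S (M + b) i = s b i) -> value S (shift_expr M e) = value s e.
Proof. by move=> sS; elim: e => //= [b e ->|e -> f ->|e -> f ->|e ->]. Qed.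

Lemma exec_shift M p s t s' : exec p s t s' ->
  forall S : state, (forall b i, S (M + b) i = s b i) ->
  exists2 S', exec (shift M p) S t S' &
    (forall b i, S' (M + b) i = s' b i) /\ (forall b i, b < M -> S' b i = S b i).
Proof.
elim=> //= {p s t s'}.
- by move=> s S sS; exists S => //; constructor.
- move=> b i e s S sS; eexists; first by constructor.
  split=> b' i'; first by rewrite !updateE eqn_add2l !(value_shift _ sS) sS.
  by rewrite updateE => lt_b; rewrite ltn_eqF // ltn_addr.
- move=> p q s1 s2 s3 t1 t2 _ IH1 _ IH2 S /IH1 [S2 e1 [/IH2 [S3 e2 [h3 k3]] k2]].
  exists S3; first exact: ExecSeq e1 e2.
  by split=> // b i lt_b; rewrite k3 ?k2.
- move=> e p q s t s' v0 _ IH S sS; have [S' ex h] := IH S sS.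
  by exists S' => //; apply: ExecIfTrue; rewrite ?(value_shift _ sS).
- move=> e p q s t s' v0 _ IH S sS; have [S' ex h] := IH S sS.
  by exists S' => //; apply: ExecIfFalse; rewrite ?(value_shift _ sS).
- move=> e p s1 s2 s3 t1 t2 v0 _ IH1 _ IH2 S sS.
  have [S2 e1 [/IH2 [S3 e2 [h3 k3]] k2]] := IH1 S sS.
  exists S3; last by split=> // b i lt_b; rewrite k3 ?k2.
  by apply: ExecWhileTrue e1 e2; rewrite (value_shift _ sS).
- by move=> e p s v0 S sS; exists S => //; apply: ExecWhileFalse; rewrite (value_shift _ sS).
Qed.

Definition copy (b b' r : nat) : prog :=
  For r 0 (Add (Cell b (Cst 0)) (Cst 1))
    (Assign b' (Cell r (Cst 0)) (Cell b (Cell r (Cst 0)))).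

Lemma wp_copy b b' r s : b != b' -> r != b -> r != b' ->
  wp ((s b 0).+1 * 3 + 2) (copy b b' r) s (fun s' =>
    [/\ forall i, s' b' i = if i <= s b 0 then s b i else s b' i
      & forall c i, c != b' -> c != r -> s' c i = s c i]).
Proof.
move=> nbb nrb nrb'.
pose I j (s' : state) :=
    [/\ forall i, s' b' i = if i < j then s b i else s b' i
      & forall c i, c != b' -> c != r -> s' c i = s c i].
have nbr : b == r = false by rewrite eq_sym; apply/negbTE.
have nb'r : b' == r = false by rewrite eq_sym; apply/negbTE.
apply: wp_weaken (wp_for (I := I) (N := (s b 0).+1) (n := 1) _ _ _) => //.
- by move=> s' [_ []].
- by move=> j s' _ _ [_ h] /=; rewrite h // ?addn1 1?eq_sym.
- move=> j s' _ sj [h k]; apply: wp_assign => /=.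
  rewrite sj updateE (negbTE nrb') /=; split=> //; split=> [i|c i ncb' ncr].
    rewrite !updateE nb'r eqxx /= ltnS k ?nbr // h.
    by case: ltngtP => [||->].
  by rewrite !updateE (negbTE ncb') (negbTE ncr) /= k.
- by split=> [i|c i ncb' ncr]; rewrite updateE ?nb'r ?(negbTE ncr).
Qed.

(** [q] expects a memory that is zero apart from its input, but [p] leaves its banks dirty. So [q]
    is relocated beyond the banks of [p]; bank [M] is reserved for the counter of the two copies. *)
Definition compose (p q : prog) : prog :=
  let M := (banks p).+1 in
  Seq p (Seq (copy 0 M.+1 M) (Seq (shift M.+1 q) (copy M.+1 0 M))).

Lemma computes_compose p q w w1 w2 t1 t2 :
  computes p w t1 w1 -> computes q w1 t2 w2 ->
  exists2 t, t <= t1 + t2 + 3 * (size w1 + size w2) + 10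
    & computes (compose p q) w t w2.
Proof.
move=> [s1 e1 r1] [s2 e2 r2]; rewrite /compose; set M := (banks p).+1.
suff [t [s' [ex le_t res]]] : wp (t1 + (((size w1).+1 * 3 + 2) + (t2 + ((size w2).+1 * 3 + 2))))
    (Seq p (Seq (copy 0 M.+1 M) (Seq (shift M.+1 q) (copy M.+1 0 M)))) (init w) (result w2).
  by exists t; [apply: leq_trans le_t _; lia | exists s'].
have s10 : s1 0 0 = size w1 by apply: r1.
have big b i : M <= b -> s1 b i = 0.
  move=> Mb; rewrite (exec_frame e1) /init; last by apply: ltnW.
  by case: b Mb.
apply: wp_seq; exists t1, s1; split=> //.
apply: wp_seq; rewrite -s10; apply: wp_weaken (wp_copy _ _ _ _) => // [s3 [h3 k3]|]; last first.
  by rewrite neq_ltn ltnSn.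
have [S' ex [hS kS]]: exists2 S', exec (shift M.+1 q) s3 t2 S' &
    (forall b i, S' (M.+1 + b) i = s2 b i) /\ (forall b i, b < M.+1 -> S' b i = s3 b i).
  apply: exec_shift e2 _ _ => -[|b] i.
    rewrite addn0 h3 s10; case: leqP => [le_i|lt_i]; first exact: r1.
    by rewrite big ?leqnSn //; symmetry; apply: nth_default.
  rewrite k3 ?big //; lia.
apply: wp_seq; exists t2, S'; split=> //.
have S0 : S' M.+1 0 = size w2 by rewrite -[M.+1]addn0 hS r2.
rewrite -S0; apply: wp_weaken (wp_copy _ _ _ _) => //; last by rewrite neq_ltn ltnSn.
move=> s4 [h4 _] i le_i; rewrite h4 S0 le_i -[M.+1]addn0 hS; exact: r2.
Qed.

(** * Computable functions for the bounds *)

Lemma computable_comp f g :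
  computable f -> computable g -> computable (fun n => g (f n)).
Proof.
move=> [p Hp] [q Hq]; exists (compose p q) => n.
have [t1 e1] := Hp n; have [t2 e2] := Hq (f n).
by have [t _ ex] := computes_compose e1 e2; exists t.
Qed.

Lemma wp_computable p f :
  (forall n, exists t, wp t p (init [:: n]) (result [:: f n])) -> computable f.
Proof.
move=> H; exists p => n; have [t [t' [s [ex _ r]]]] := H n.
by exists t'; exists s.
Qed.

Lemma resultP v (s : state) : s 0 0 = 1 -> s 0 1 = v -> result [:: v] s.
Proof. by move=> s0 s1 [|[|i]]. Qed.

Lemma computable_cst c : computable (fun=> c).
Proof.
apply: (@wp_computable (Assign 0 (Cst 1) (Cst c))) => n.
by exists 1; apply: wp_assign; apply: resultP.
Qed.

Lemma computable_exp2 : computable (expn 2).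
Proof.
apply: (@wp_computable (Seq (Assign 1 (Cst 0) (Cst 1))
  (Seq (For 1 1 (Cell 0 (Cst 1))
          (Assign 1 (Cst 0) (Add (Cell 1 (Cst 0)) (Cell 1 (Cst 0)))))
       (Assign 0 (Cst 1) (Cell 1 (Cst 0)))))) => n.
eexists; apply/wp_seq/wp_assign/wp_seq => /=.
pose I j (s : state) := [/\ s 0 0 = 1, s 0 1 = n & s 1 0 = 2 ^ j].
apply: wp_weaken (wp_for (I := I) (N := n) (n := 1) _ _ _) => //.
- by move=> s [_ [s0 s1 s2]]; apply: wp_assign; apply: resultP.
- by move=> j s _ _ [_ /= -> _].
- move=> j s _ sj [s0 s1 s2]; apply: wp_assign; split=> //=.
  by split; rewrite ?updateE //= s2 expnS mul2n addnn.
Qed.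

(** Both programs are relocated to disjoint ranges of banks, and bank 0 is kept intact so that the
    second one still finds the argument. *)
Lemma computable_add f g :
  computable f -> computable g -> computable (fun n => f n + g n).
Proof.
move=> [p Hp] [q Hq]; pose M := (banks (shift 1 p)).+2.
apply: (@wp_computable
  (Seq (Assign 1 (Cst 0) (Cst 1)) (Seq (Assign 1 (Cst 1) (Cell 0 (Cst 1)))
  (Seq (shift 1 p)
  (Seq (Assign M (Cst 0) (Cst 1)) (Seq (Assign M (Cst 1) (Cell 0 (Cst 1)))
  (Seq (shift M q)
  (Assign 0 (Cst 1) (Add (Cell 1 (Cst 1)) (Cell M (Cst 1))))))))))) => n.
have [t1 [s1 e1 r1]] := Hp n; have [t2 [s2 e2 r2]] := Hq n.
eexists; do 2![apply/wp_seq/wp_assign] => /=.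
set s := update _ _ _ _.
have [S1 ex1 [h1 k1]]: exists2 S', exec (shift 1 p) s t1 S' &
    (forall b i, S' (1 + b) i = s1 b i) /\ (forall b i, b < 1 -> S' b i = s b i).
  by apply: exec_shift e1 _ _ => -[|b] [|[|i]] //=; rewrite /s /update /init /= ?nth_nil.
apply: wp_seq; exists t1, S1; split; [exact: ex1 | exact: leqnn |].
do 2![apply/wp_seq/wp_assign] => /=.
set s3 := update _ _ _ _.
have bM b i : S1 (M + b) i = 0.
  by rewrite (exec_frame ex1) // /M -[_.+2]addn2 -addnA leq_addr.
have [S2 ex2 [h2 k2]]: exists2 S', exec (shift M q) s3 t2 S' &
    (forall b i, S' (M + b) i = s2 b i) /\ (forall b i, b < M -> S' b i = s3 b i).
  apply: exec_shift e2 _ _ => b i.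
  have Mb : (M + b == M) = (b == 0) by rewrite -[X in _ == X]addn0 eqn_add2l.
  rewrite /s3 /update Mb bM k1 // => {Mb}.
  by case: b i => [|b] [|[|i]] //=; rewrite /init /= ?nth_nil.
apply: wp_seq; exists t2, S2; split; [exact: ex2 | exact: leqnn |].
apply: wp_assign; apply: resultP; rewrite updateE /=.
  by rewrite k2 // /s3 /update /= k1.
rewrite k2 // /s3 /update /= -[1]addn0 h1 r1 //.
by rewrite -[M]addn0 h2 r2.
Qed.

(** * Networks with unit capacities and transit times *)

Lemma edge_tupleK : cancel (fun e => (tail e, head e, cap e, time e))
  (fun p => let: (t, h, c, d) := p in Edge t h c d).
Proof. by case. Qed.

HB.instance Definition _ := Equality.copy edge (can_type edge_tupleK).

Lemma arc_tupleK : cancel (fun a => (src a, dst a, acap a, atime a))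
  (fun p => let: (t, h, c, d) := p in Arc t h c d).
Proof. by case. Qed.

HB.instance Definition _ := Equality.copy arc (can_type arc_tupleK).

Definition unit_network (N : network) : bool :=
  all (fun e => (cap e == 1) && (time e == 1)) (edges N).

Definition unit_arcs (directed : bool) (e : edge) : seq arc :=
  let forward := Arc (inl (tail e)) (inl (head e)) 1 1 in
  let backward := Arc (inl (head e)) (inl (tail e)) 1 1 in
  if directed then [:: forward] else [:: forward; backward].

Lemma arcs_unit directed N X : unit_network N ->
  arcs directed N X = flatten [seq unit_arcs directed e | e <- edges N].
Proof.
rewrite /unit_network => /allP unitN; rewrite /arcs -[in RHS](mkseq_nth edge0 (edges N)) /mkseq -map_comp.
congr flatten; apply/eq_in_map => j; rewrite mem_iota /= => lt_j.
have /andP[/eqP c1 /eqP t1] := unitN _ (mem_nth edge0 lt_j).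
have st : stops N X j = [:: 0; 1] by rewrite /stops t1.
by rewrite /edge_arcs st /= /point t1 c1 /unit_arcs /=; case: directed.
Qed.

Definition linked (directed : bool) (N : network) (X : seq position) (v : nat) :=
  exists2 e, e \in edges N &
    tail e = v /\ inl (head e) \in X \/
    ~~ directed /\ head e = v /\ inl (tail e) \in X.

Section Unit.
Import Order.TTheory GRing.Theory Num.Theory.
Variables (R : realType) (directed : bool) (N : network) (X : seq position).
Hypotheses (wfN : wf_network directed N) (unitN : unit_network N).
Hypotheses (uniqX : uniq X) (posX : all (is_position N) X).

Let A := arcs directed N X.
Let arc_of (a : 'I_(size A)) : arc := tnth (in_tuple A) a.
Let n := order N.

Lemma unit_arcP (a : 'I_(size A)) : exists2 e,
  e \in edges N & arc_of a \in unit_arcs directed e.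
Proof.
have: arc_of a \in A := mem_tnth a (in_tuple A).
move: (arc_of a) => b; rewrite /A arcs_unit //.
by move=> /flattenP[_ /mapP[e eN ->]]; exists e.
Qed.

Lemma unit_arc_cap (a : 'I_(size A)) : acap (arc_of a) = 1.
Proof.
have [e _] := unit_arcP a; rewrite /unit_arcs; case: directed; rewrite !inE.
  by move/eqP->.
by case/orP => /eqP ->.
Qed.

Lemma unit_arc_time (a : 'I_(size A)) : atime (arc_of a) = 1.
Proof.
have [e _] := unit_arcP a; rewrite /unit_arcs; case: directed; rewrite !inE.
  by move/eqP->.
by case/orP => /eqP ->.
Qed.

Lemma wf_edges e : e \in edges N -> [&& tail e < n, head e < n & tail e != head e].
Proof.
by move: wfN => /andP[/allP wf _] /wf/and4P[-> -> -> _].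
Qed.

Lemma unit_arc_src (a : 'I_(size A)) :
  exists u : 'I_n, src (arc_of a) = inl (u : nat).
Proof.
have [e /wf_edges/and3P[tn hn _]] := unit_arcP a.
rewrite /unit_arcs; case: directed; rewrite !inE.
  by move/eqP->; exists (Ordinal tn).
by case/orP => /eqP ->; [exists (Ordinal tn) | exists (Ordinal hn)].
Qed.

Lemma unit_arc_dst (a : 'I_(size A)) :
  exists u : 'I_n, dst (arc_of a) = inl (u : nat).
Proof.
have [e /wf_edges/and3P[tn hn _]] := unit_arcP a.
rewrite /unit_arcs; case: directed; rewrite !inE.
  by move/eqP->; exists (Ordinal hn).
by case/orP => /eqP ->; [exists (Ordinal hn) | exists (Ordinal tn)].
Qed.

Lemma linked_arc (v : nat) : linked directed N X v <->
  exists a : 'I_(size A), src (arc_of a) = inl v /\ dst (arc_of a) \in X.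
Proof.
split=> [[e eN h]|[a [sa da]]].
  have [b bA [sb db]] : exists2 b, b \in A & src b = inl v /\ dst b \in X.
    rewrite /A arcs_unit //; rewrite /unit_arcs.
    case: h => [[<- hX]|[/negbTE -> [<- hX]]].
      exists (Arc (inl (tail e)) (inl (head e)) 1 1) => //.
      apply/flattenP; eexists; first by apply: map_f eN.
      by case: directed; rewrite !inE eqxx.
    exists (Arc (inl (head e)) (inl (tail e)) 1 1) => //.
    apply/flattenP; eexists; first by apply: map_f eN.
    by rewrite !inE eqxx orbT.
  have lt_b : index b A < size A by rewrite index_mem.
  by exists (Ordinal lt_b); rewrite /arc_of (tnth_nth b) /= nth_index.
have [e eN eA] := unit_arcP a; exists e => //; move: eA sa da.
rewrite /unit_arcs; case: directed; rewrite !inE.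
  by move=> /eqP -> /= [<-]; left.
by move=> /orP[] /eqP -> /= [<-]; [left|right].
Qed.

Local Open Scope ring_scope.

(** An edge of transit time 1 has no position in its interior. *)
Lemma sink_vertex p : p \in X -> exists v : 'I_n, p = inl (v : nat).
Proof.
move=> /(allP posX); case: p => [v vn|[j i]] /=; first by exists (Ordinal vn).
case/andP=> lt_j; have /allP/(_ _ (mem_nth edge0 lt_j))/andP[_ /eqP ->] := unitN.
by case: i => [|[|i]].
Qed.

Lemma big_sinks (f : position -> R) :
  \sum_(x <- X) f x = \sum_(v < n | inl (v : nat) \in X) f (inl (v : nat)).
Proof.
rewrite -(big_mkord (fun v => inl v \in X) (fun v => f (inl v))).
rewrite -big_filter -(big_map inl xpredT f); apply: perm_big.
apply: uniq_perm => //.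
  rewrite map_inj_uniq ?filter_uniq ?iota_uniq //; by move=> x y [].
move=> p; apply/idP/mapP => [pX|[v]]; last by rewrite mem_filter => /andP[? _] ->.
by have [v vE] := sink_vertex pX; exists (v : nat) => //; rewrite mem_filter -vE pX mem_index_iota ltn_ord.
Qed.

Lemma big_vertex (loc : 'I_(size A) -> position) (P : pred 'I_(size A))
    (Q : pred position) (f : 'I_(size A) -> R) :
  (forall a, exists u : 'I_n, loc a = inl (u : nat)) ->
  \sum_(a | P a && Q (loc a)) f a =
  \sum_(v < n | Q (inl (v : nat))) \sum_(a | (loc a == inl (v : nat)) && P a) f a.
Proof.
move=> vertex_loc.
have E v : \sum_(a | (loc a == inl (nat_of_ord v)) && P a) f a =
    \sum_(a | P a) (if loc a == inl (v : nat) then f a else 0).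
  by rewrite -big_mkcondr; apply: eq_bigl => a; rewrite andbC.
under [RHS]eq_bigr => v _ do rewrite E.
rewrite exchange_big /= big_mkcondr; apply: eq_bigr => a Pa.
have [u uE] := vertex_loc a; rewrite uE.
case: ifP => Qu; last first.
  by rewrite big1 // => v Qv; case: eqP => // -[uv]; rewrite uv Qv in Qu.
rewrite (bigD1 u) //= eqxx big1 ?addr0 // => v /andP[_ nvu].
by case: eqP => // -[/val_inj uv]; rewrite uv eqxx in nvu.
Qed.

Lemma total_sinks : (total_supply N)%:R =
  \sum_(v < n | inl (v : nat) \in X) (supply_at N (inl (v : nat)))%:R +
  \sum_(v < n | inl (v : nat) \notin X) (supply_at N (inl (v : nat)))%:R :> R.
Proof. by rewrite /total_supply natr_sum (bigID (fun v : 'I_n => inl (v : nat) \in X)). Qed.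

Lemma sum_stock (F : flow R directed N X) t :
  \sum_(x <- X) stock F x t =
  \sum_(v < n | inl (v : nat) \in X) (supply_at N (inl (v : nat)))%:R +
  \sum_(a | dst (arc_of a) \in X) F a (t - 1) -
  \sum_(a | src (arc_of a) \in X) F a t.
Proof.
rewrite big_sinks /stock sumrB big_split /=; congr (_ + _ - _).
  rewrite (big_vertex xpredT (mem X) _ unit_arc_dst); apply: eq_bigr => v _.
  apply: eq_big => a; first by rewrite andbT.
  by rewrite [tnth _ a]/(arc_of a) unit_arc_time.
rewrite (big_vertex xpredT (mem X) _ unit_arc_src); apply: eq_bigr => v _.
by apply: eq_bigl => a; rewrite andbT.
Qed.

(** Time 2 leaves room for one arc only: what arrives at a sink by time 2 entered its last arc by
    time 1, when nothing had yet arrived anywhere. So only initial supply of vertices with an arc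
    into [X] can reach a sink, and a source without such an arc leaves the total short by its
    unit. *)
Lemma routable_linked v0 : routable R directed N X 2 ->
  (v0 < n)%N -> supply_at N (inl v0) = 1%N ->
  inl v0 \in X \/ linked directed N X v0.
Proof.
move=> [F [F0 Finc Fst]]; rewrite sum_stock total_sinks => tot lt_v0 sup_v0.
have Fmon a s t : s <= t -> F a s <= F a t.
  by move=> le_st; have /andP[] := Finc a s t le_st; rewrite subr_ge0.
have Fge0 a t : 0 <= t -> 0 <= F a t by move=> t0; rewrite -(F0 a 0) ?Fmon.
pose out v := [exists a, (src (arc_of a) == inl v) && (dst (arc_of a) \in X)].
have [v0X|v0X] := boolP (inl v0 \in X); first by left.
right; apply/linked_arc.
have [/existsP[a /andP[/eqP ? ?]]|outv0] := boolP (out v0); first by exists a.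
exfalso.
(* At time 1 no inflow has reached [v], so what has left it is at most its own supply. *)
have out_le v : \sum_(a | (src (arc_of a) == inl v) && (dst (arc_of a) \in X)) F a 1
    <= if out v then (supply_at N (inl v))%:R else 0.
  case: ifP => [_|/negbT nout]; last first.
    rewrite big1 // => a; have /existsPn/(_ a)/negbTE -> // := nout.
  have := Fst (inl v) 1; rewrite /stock [X in _ + X - _]big1 => [|a _]; last first.
    by rewrite [tnth _ a]/(arc_of a) unit_arc_time subrr F0.
  rewrite addr0 subr_ge0; apply: le_trans.
  rewrite big_mkcondr; apply: ler_sum => a _; case: ifP => // _; exact: Fge0.
(* What enters sinks from other sinks is offset by the outflow of the sinks. *)
have split_in : \sum_(a | dst (arc_of a) \in X) F a (2%:R - 1) <=
    \sum_(a | src (arc_of a) \in X) F a 2%:R +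
    \sum_(v < n | inl (v : nat) \notin X)
       (if out v then (supply_at N (inl (v : nat)))%:R else 0).
  have -> : 2%:R - 1 = 1 :> R by lra.
  rewrite (bigID (fun a => src (arc_of a) \in X)) /=; apply: lerD.
    rewrite [leRHS]big_mkcond [leLHS]big_mkcond; apply: ler_sum => a _.
    case: (src _ \in X); rewrite ?andbF // andbT; case: ifP => _.
      by apply: Fmon; lra.
    by apply: Fge0; lra.
  rewrite (big_vertex (fun a => dst (arc_of a) \in X) [predC X] _ unit_arc_src).
  by apply: ler_sum => v _; apply: out_le.
move: tot => /eqP; rewrite -subr_eq0 => /eqP tot.
have: \sum_(v < n | inl (v : nat) \notin X)
       (if out v then (supply_at N (inl (v : nat)))%:R else 0) <
    \sum_(v < n | inl (v : nat) \notin X) (supply_at N (inl (v : nat)))%:R :> R.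
  rewrite (bigD1 (Ordinal lt_v0)) //= [ltRHS](bigD1 (Ordinal lt_v0)) //=.
  rewrite [odflt _ _]sup_v0 (negbTE outv0) add0r -[ltLHS]add0r ltr_leD ?ltr01 //.
  by apply: ler_sum => v _; case: ifP.
by move: tot split_in; lra.
Qed.

(** Every source outside [X] sends its unit at rate 1 during the first time unit along one chosen
    arc into [X]. Distinct sources use distinct arcs, so unit capacities suffice, and all has
    arrived at time 2. *)
Lemma linked_routable :
  (forall v, v < n -> supply_at N (inl v) <= 1)%N ->
  (forall v, (v < n)%N -> supply_at N (inl v) = 1%N ->
     inl v \in X \/ linked directed N X v) ->
  routable R directed N X 2.
Proof.
move=> sup1 linkedN.
pose needy p := (supply_at N p == 1%N) && (p \notin X).
pose route p := [pick b | (src (arc_of b) == p) && (dst (arc_of b) \in X)].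
pose chosen a := needy (src (arc_of a)) && (route (src (arc_of a)) == Some a).
have chosen_dst a : chosen a -> dst (arc_of a) \in X.
  case/andP=> _ /eqP; rewrite /route; case: pickP => // b /andP[_ bX] [<-].
  exact: bX.
(* The cumulative inflow of a flow of rate 1 between times 0 and 1. *)
pose ramp (t : R) := Num.max 0 (Num.min 1 t).
have ramp_ge0 t : 0 <= ramp t by rewrite le_max lexx.
have ramp1 t : 1 <= t -> ramp t = 1.
  by move=> t1; rewrite /ramp (min_idPl t1) (max_idPr ler01).
have ramp_le1 t : ramp t <= 1 by rewrite ge_max ler01 ge_min lexx.
pose F : flow R directed N X := fun a t => if chosen a then ramp t else 0.
have sumF p t : \sum_(a | src (arc_of a) == p) F a t =
    if needy p && (route p : bool) then ramp t else 0.
  rewrite -big_mkcondr /=.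
  have -> : \sum_(a | (src (arc_of a) == p) && chosen a) ramp t =
     \sum_(a | needy p && (route p == Some a)) ramp t.
    apply: eq_bigl => a; rewrite /chosen; case: eqP => [->//|np] /=.
    apply/esym/negbTE; rewrite negb_and orbC; apply/orP; left; apply/eqP.
    by rewrite /route; case: pickP => // b /andP[/eqP ? _] [ba]; apply: np; rewrite -ba.
  case: (needy p) => /=; last by rewrite big_pred0.
  case: (route p) => [a|] /=; last by rewrite big_pred0.
  by rewrite (bigD1 a) //= big1 ?addr0 // => b /andP[/eqP[->]]; rewrite eqxx.
exists F; first split.
- move=> a t t0; rewrite /F; case: ifP => // _; rewrite /ramp.
  have le_t1 : t <= 1 by lra.
  by rewrite (min_idPr le_t1) (max_idPl t0).
- move=> a s t st; rewrite [tnth _ a]/(arc_of a) unit_arc_cap mul1r /F.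
  case: ifP => _; last by rewrite subrr lexx subr_ge0.
  rewrite /ramp /Num.max /Num.min.
  by case: (ltP 1 s) (ltP 1 t) => ? [] ?; do ?case: ifP; move=> *; apply/andP; split; lra.
- move=> p t; rewrite /stock (sumF p t).
  rewrite -addrA addrCA addr_ge0 ?sumr_ge0 // => [a _|]; first by rewrite /F; case: ifP.
  rewrite subr_ge0; case: ifP => [/andP[/andP[/eqP -> _] _]|_]; last exact: ler0n.
  exact: ramp_le1.
rewrite sum_stock total_sinks [X in _ - X]big1 => [|a aX]; last first.
  by rewrite /F /chosen /needy aX andbF.
rewrite subr0; congr (_ + _).
have -> : \sum_(a | dst (arc_of a) \in X) F a (2%:R - 1) =
    \sum_(a | true && true) F a 1.
  rewrite [LHS]big_mkcond; apply: eq_bigr => a _.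
  have -> : 2%:R - 1 = 1 :> R by lra.
  by case: ifP => // /negP aX; rewrite /F; case: ifP => // /chosen_dst.
rewrite (big_vertex xpredT xpredT _ unit_arc_src) [RHS]big_mkcond.
apply: eq_bigr => v _; under eq_bigl => a do rewrite andbT.
rewrite sumF ramp1 // /needy.
have := sup1 v (ltn_ord v); case: eqP => [sv _|sv]; last first.
  rewrite leq_eqVlt ltnS leqn0 => /orP[/eqP //|/eqP ->] /=.
  by case: ifP.
have [vX|vX] := boolP (inl (v : nat) \in X); first by rewrite ?andbF.
have [|/linked_arc [a [sa da]]] := linkedN _ (ltn_ord v) sv; first by rewrite (negbTE vX).
rewrite ?sv ?eqxx /route /=; case: pickP => [//|/(_ a)].
by rewrite sa da eqxx.
Qed.
End Unit.

(** The problem asks for some network with the given code, so a no-instance requires that the code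
    determines the network. *)
Lemma encode_network_inj N N' T T' :
  encode_network N T = encode_network N' T' -> N = N' /\ T = T'.
Proof.
case: N N' => [sup E] [sup' E'] [-> eq_sz eq_szE /eqP].
rewrite eqseq_cat ?size_map // => /andP[/eqP eq_sup /eqP eq_E]; split=> //.
have -> : sup = sup' by apply: (inj_map _ eq_sup) => -[m|] [m'|] //= [->].
suff -> : E = E' by [].
elim: E E' eq_szE eq_E {eq_sz eq_sup} => [|[a b c d] E IH] [|[a' b' c' d'] E'] //= [eq_sz].
by move=> [-> -> -> -> /(IH _ eq_sz) ->].
Qed.

(** * Covering problems as sink location problems *)

Definition cover_edges (ns ne : nat) (r : nat -> nat -> bool) : seq edge :=
  [seq Edge (ns + j) u 1 1 | j <- iota 0 ne, u <- [seq u <- iota 0 ns | r j u]].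

(** Vertices below [ns] are the sets, the others the elements with one unit each. Edges go from
    elements to sets and sets have no supply, so directed and undirected networks yield the same
    covering condition. *)
Definition cover_network (ns ne : nat) (r : nat -> nat -> bool) : network :=
  Network (nseq ns None ++ nseq ne (Some 1)) (cover_edges ns ne r).

Lemma cover_edgeP ns ne (r : nat -> nat -> bool) e :
  reflect (exists j u, [/\ j < ne, u < ns, r j u & e = Edge (ns + j) u 1 1])
    (e \in cover_edges ns ne r).
Proof.
apply: (iffP allpairsPdep) => [[j [u []]]|[j [u [lt_j lt_u rju ->]]]].
  rewrite mem_filter !mem_iota /= !add0n => lt_j /andP[rju lt_u] ->.
  by exists j, u.
by exists j, u; rewrite mem_filter !mem_iota rju.
Qed.

Lemma cover_network_order ns ne r : order (cover_network ns ne r) = ns + ne.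
Proof. by rewrite /order /= size_cat !size_nseq. Qed.

Lemma cover_network_supply ns ne (r : nat -> nat -> bool) v : v < ns + ne ->
  supply_at (cover_network ns ne r) (inl v) = (ns <= v).
Proof.
move=> lt_v; rewrite /= nth_cat size_nseq !nth_nseq.
by case: ltnP => // le_v; rewrite ltn_subLR // lt_v.
Qed.

Lemma cover_network_wf directed ns ne r : wf_network directed (cover_network ns ne r).
Proof.
apply/andP; split.
  apply/allP => e /cover_edgeP[j [u [lt_j lt_u _ ->]]].
  by rewrite /wf_edge cover_network_order /= andbT; lia.
rewrite map_inj_in_uniq.
  apply: allpairs_uniq_dep; rewrite ?iota_uniq //.
    by move=> j _; rewrite filter_uniq ?iota_uniq.
  by move=> [j u] [j' u'] _ _ /= [/addnI -> ->].
move=> e e' /cover_edgeP[j [u [lt_j lt_u _ ->]]] /cover_edgeP[j' [u' [lt_j' lt_u' _ ->]]].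
rewrite /endpoints; case: directed => /= -[]; first by move=> /addnI -> ->.
by move=> ? ?; congr Edge; lia.
Qed.

Lemma cover_network_unit ns ne r : unit_network (cover_network ns ne r).
Proof. by apply/allP => e /cover_edgeP[j [u [_ _ _ ->]]]. Qed.

Lemma cover_network_linked directed ns ne (r : nat -> nat -> bool) Y j : j < ne ->
  linked directed (cover_network ns ne r) (map inl Y) (ns + j) <->
  has (fun u => (u < ns) && r j u) Y.
Proof.
have inl_inj : injective (@inl nat (nat * nat)) by move=> ? ? [].
move=> lt_j; split=> [[e /cover_edgeP[j' [u [lt_j' lt_u rju ->]]] /=]|].
  rewrite !(mem_map inl_inj) => -[[/addnI eq_j uY]|[_ []]]; last by lia.
  by apply/hasP; exists u => //; rewrite lt_u -eq_j.
case/hasP=> u uY /andP[lt_u rju]; exists (Edge (ns + j) u 1 1).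
  by apply/cover_edgeP; exists j, u.
by left; rewrite (mem_map inl_inj).
Qed.

(** A sink may also sit on an element, which it then covers alone; this is the only difference from
    an ordinary covering problem. *)
Lemma k_sink_cover (R : realType) directed ns ne (r : nat -> nat -> bool) k :
  k_sink_location R directed (encode_network (cover_network ns ne r) 2) k <->
  exists X : seq nat,
    [/\ uniq X, size X = k, all (fun v => v < ns + ne) X
      & forall j, j < ne -> (ns + j \in X) || has (fun u => (u < ns) && r j u) X].
Proof.
have inl_inj : injective (@inl nat (nat * nat)) by move=> ? ? [].
set N := cover_network ns ne r.
have wfN := cover_network_wf directed ns ne r; have unitN := cover_network_unit ns ne r.
have sup j : j < ne -> supply_at N (inl (ns + j)) = 1.
  by move=> lt_j; rewrite cover_network_supply ?ltn_add2l // leq_addr.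
split=> [[N' [T [/encode_network_inj[<- <-] _ [X [uniqX szX posX rX]]]]]|[Y [uniqY szY ltY covY]]].
  have EX : X = map inl [seq (if p is inl u then u else 0) | p <- X].
    rewrite -map_comp -[LHS]map_id; apply/eq_in_map => p pX.
    by have [v ->] := sink_vertex unitN posX pX.
  rewrite EX in uniqX szX posX rX; move: uniqX szX posX rX.
  set Y := map _ X; rewrite map_inj_uniq // size_map all_map => uniqY szY ltY rY.
  exists Y; split=> //.
    by apply: sub_all ltY => v /=; rewrite cover_network_order.
  move=> j lt_j; have := routable_linked wfN unitN _ _ rY (v0 := ns + j).
  rewrite map_inj_uniq // all_map cover_network_order ltn_add2l sup // => /(_ uniqY ltY lt_j erefl).
  rewrite (mem_map inl_inj) => -[->//|/(cover_network_linked directed ns r Y lt_j) ->].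
  by rewrite orbT.
exists N, 2; split=> //; exists (map inl Y).
have uX : uniq (map (@inl nat (nat * nat)) Y) by rewrite map_inj_uniq.
have posX : all (is_position N) (map inl Y).
  by rewrite all_map; apply: sub_all ltY => v /=; rewrite cover_network_order.
split; rewrite ?size_map //; apply: linked_routable => //.
  by move=> v lt_v; rewrite cover_network_supply ?leq_b1 // -(cover_network_order _ _ r).
move=> v; rewrite cover_network_order => lt_v; rewrite cover_network_supply //.
case: leqP => // le_v _; rewrite (mem_map inl_inj).
have vE : v = ns + (v - ns) by rewrite subnKC.
have lt_j : v - ns < ne by rewrite ltn_subLR.
have := covY _ lt_j; rewrite -vE => /orP[->|h]; first by left.
by right; rewrite vE; apply/cover_network_linked.
Qed.

(** * Circuits *)

Section Labels.
Variables (A : Type) (F : nat -> seq A -> gate -> A).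

Lemma labels_rcons C g :
  labels F (rcons C g) = rcons (labels F C) (F (size (labels F C)) (labels F C) g).
Proof. by rewrite /labels -cats1 foldl_cat. Qed.

Lemma size_labels C : size (labels F C) = size C.
Proof. by elim/last_ind: C => // C g IH; rewrite labels_rcons !size_rcons IH. Qed.

Lemma nth_labels x0 C j : j < size C ->
  nth x0 (labels F C) j = F j (take j (labels F C)) (nth Input C j).
Proof.
elim/last_ind: C => // C g IH; rewrite size_rcons ltnS leq_eqVlt labels_rcons.
rewrite !nth_rcons size_labels -cats1 take_cat size_labels.
case: eqP => [->|_ /= lt_j]; last by rewrite lt_j IH.
by rewrite ltnn subnn take0 cats0.
Qed.
End Labels.

Definition gate_tag (g : gate) : nat :=
  match g with Input => 0 | Not _ => 1 | And _ => 2 | Or _ => 3 end.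

Lemma all_index (p : pred nat) s : all p s = all (fun i => p (nth 0 s i)) (iota 0 (size s)).
Proof. by rewrite -[in LHS](mkseq_nth 0 s) all_map. Qed.

(** The game sees the circuit only through these functions. The machine provides them for every
    word, even one that encodes no circuit. *)
Record represents (tg ln : nat -> nat) (pr : nat -> nat -> nat) (C : circuit) : Prop := {
  tgE : forall v, v < size C -> tg v = gate_tag (nth Input C v);
  lnE : forall v, v < size C -> ln v = size (preds (nth Input C v));
  prE : forall v i, v < size C -> i < ln v -> pr v i = nth 0 (preds (nth Input C v)) i }.

Section Walk.
Variables (ln : nat -> nat) (pr : nat -> nat -> nat).

(* The walk from v that goes at step j to the predecessor with index y (i + j),
   and stops if there is none, reaches an input if it takes f steps, and goes on
   from at most r gates of fan-in larger than 2. *)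
Fixpoint okwalk (y : nat -> nat) (f i r v : nat) : bool :=
  if f is f'.+1 then
    [|| ln v <= y i,
        (ln v <= 2) && okwalk y f' i.+1 r (pr v (y i))
      | (2 < ln v) && (if r is r'.+1 then okwalk y f' i.+1 r' (pr v (y i)) else false)]
  else ln v == 0.

Lemma okwalk_ext y y' f i r v : (forall j, i <= j < i + f -> y j = y' j) ->
  okwalk y f i r v = okwalk y' f i r v.
Proof.
elim: f i r v => //= f IH i r v yy'; rewrite yy' ?leqnn ?addnS ?ltnS ?leq_addr //.
have h j : i < j < i.+1 + f -> y j = y' j by move=> /andP[h1 h2]; apply: yy'; lia.
by rewrite IH //; case: r => // r; rewrite IH.
Qed.

End Walk.

Section Circuit.
Variables (tg ln : nat -> nat) (pr : nat -> nat -> nat) (C : circuit).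
Hypotheses (repC : represents tg ln pr C) (wfC : wf_circuit C).
Let n := size C.

Lemma wf_gate_at v : v < n -> wf_gate v (nth Input C v).
Proof. by move: wfC => /andP[_ /forallP h] lt_v; apply: (h (Ordinal lt_v)). Qed.

Lemma pr_lt v i : v < n -> i < ln v -> pr v i < v.
Proof.
move=> lt_v lt_i; rewrite (prE repC) //; have /and3P[/allP h _ _] := wf_gate_at lt_v.
by apply: h; rewrite mem_nth // -(lnE repC).
Qed.

Lemma ln_le v : v < n -> ln v <= v.
Proof.
move=> lt_v; rewrite (lnE repC) //; have /and3P[/allP h u _] := wf_gate_at lt_v.
rewrite -[leqRHS](size_iota 0); apply: uniq_leq_size => // i /h; rewrite mem_iota; lia.
Qed.

Lemma ln_gt0 v : v < n -> tg v != 0 -> 0 < ln v.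
Proof.
move=> lt_v; rewrite (tgE repC) // (lnE repC) //; have /and3P[_ _] := wf_gate_at lt_v.
by case: (nth _ _ _) => //= s; case: s.
Qed.

Lemma ln_input v : v < n -> tg v = 0 -> ln v = 0.
Proof. by move=> lt_v; rewrite (tgE repC) // (lnE repC) //; case: (nth _ _ _). Qed.

Lemma ln_not v : v < n -> tg v = 1 -> ln v = 1.
Proof. by move=> lt_v; rewrite (tgE repC) // (lnE repC) //; case: (nth _ _ _). Qed.

Lemma tg_le3 v : v < n -> tg v <= 3.
Proof. by move=> lt_v; rewrite (tgE repC) //; case: (nth _ _ _). Qed.

Lemma nth_take_pred A (x0 : A) (s : seq A) v i : v < n -> i < ln v ->
  nth x0 (take v s) (nth 0 (preds (nth Input C v)) i) = nth x0 s (pr v i).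
Proof. by move=> lt_v lt_i; rewrite -(prE repC) // nth_take // pr_lt. Qed.

Section Value.
Variable a : nat -> bool.
Let val := nth false (labels (gate_value a) C).

Lemma val_input v : v < n -> tg v = 0 -> val v = a v.
Proof.
move=> lt_v; rewrite (tgE repC) // /val nth_labels //.
by case: (nth Input C v).
Qed.

Lemma val_not v : v < n -> tg v = 1 -> val v = ~~ val (pr v 0).
Proof.
move=> lt_v tg1; have lt0 : 0 < ln v by rewrite ln_not.
rewrite /val nth_labels // -(nth_take_pred _ _ lt_v lt0).
by move: tg1; rewrite (tgE repC) //; case: (nth Input C v).
Qed.

(** The wanted value [b] exchanges conjunctions and disjunctions: a conjunction is true, or a
    disjunction false, if all predecessors have that value. This is how negations are pushed to the
    inputs. *)
Lemma val_all (b : bool) v : v < n -> tg v = (if b then 2 else 3) ->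
  (val v == b) = all (fun i => val (pr v i) == b) (iota 0 (ln v)).
Proof.
move=> lt_v tgv.
have -> : all (fun i => val (pr v i) == b) (iota 0 (ln v)) =
   all (fun i => nth false (take v (labels (gate_value a) C)) i == b) (preds (nth Input C v)).
  rewrite [RHS]all_index -(lnE repC) //; apply: eq_in_all => i; rewrite mem_iota add0n => lt_i.
  by rewrite nth_take_pred.
rewrite /val nth_labels //; move: tgv; rewrite (tgE repC) //.
case: (nth Input C v) => [|?|s|s]; case: b => //= _.
  by rewrite eqb_id; apply: eq_all => i; rewrite eqb_id.
by rewrite eqbF_neg -all_predC; apply: eq_all => i; rewrite /= eqbF_neg.
Qed.

Lemma val_has (b : bool) v : v < n -> tg v = (if b then 3 else 2) ->
  (val v == b) = has (fun i => val (pr v i) == b) (iota 0 (ln v)).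
Proof.
move=> lt_v tgv.
have := @val_all (~~ b) v lt_v; rewrite tgv; case: b {tgv} => /= /(_ erefl).
  rewrite eqb_id eqbF_neg => h; rewrite -[LHS]negbK h -has_predC.
  by apply: eq_has => i /=; rewrite eqb_id eqbF_neg negbK.
rewrite eqb_id eqbF_neg => ->; rewrite -has_predC.
by apply: eq_has => i /=; rewrite eqb_id eqbF_neg.
Qed.

Lemma satisfiesE : satisfies C a = val n.-1.
Proof. by rewrite /satisfies (last_nth false) size_labels /val /n; case: (C) wfC. Qed.
End Value.

Let dep := nth 0 (labels gate_depth C).
Let wft := nth 0 (labels gate_weft C).

Lemma depthE : depth C = dep n.-1.
Proof. by rewrite /depth (last_nth 0) size_labels /dep /n; case: (C) wfC. Qed.

Lemma weftE : weft C = wft n.-1.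
Proof. by rewrite /weft (last_nth 0) size_labels /wft /n; case: (C) wfC. Qed.

Lemma bigmax_preds (f : seq nat) v m : v < n ->
  (\max_(i <- preds (nth Input C v)) nth 0 (take v f) i <= m) =
  all (fun i => nth 0 f (pr v i) <= m) (iota 0 (ln v)).
Proof.
move=> lt_v; transitivity (all (fun i => nth 0 (take v f) i <= m) (preds (nth Input C v))).
  apply/bigmax_leqP_seq/allP => h i; first by move=> /h; apply.
  by move=> /h h' _.
rewrite all_index -(lnE repC) //; apply: eq_in_all => i; rewrite mem_iota add0n => lt_i.
by rewrite nth_take_pred.
Qed.

Lemma dep0 v : v < n -> (dep v <= 0) = (ln v == 0).
Proof.
move=> lt_v; rewrite /dep nth_labels // (lnE repC) //.
by have /and3P[_ _] := wf_gate_at lt_v; case: (nth _ _ _) => //= s; case: s.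
Qed.

Lemma depS v f : v < n ->
  (dep v <= f.+1) = all (fun i => dep (pr v i) <= f) (iota 0 (ln v)).
Proof.
move=> lt_v; rewrite -bigmax_preds // /dep nth_labels //.
by case: (nth _ _ _) => //=; rewrite big_nil.
Qed.

Lemma wftE v r : v < n ->
  (wft v <= r) = ((2 < ln v) <= r) && all (fun i => wft (pr v i) <= r - (2 < ln v)) (iota 0 (ln v)).
Proof.
move=> lt_v; rewrite -bigmax_preds // /wft nth_labels // /gate_weft -(lnE repC) //.
by case: leqP => /= h; lia.
Qed.

Local Notation okwalk := (okwalk ln pr).

Lemma okwalk_complete y f i r v : v < n -> dep v <= f -> wft v <= r -> okwalk y f i r v.
Proof.
elim: f i r v => [|f IH] i r v lt_v; first by rewrite dep0.
rewrite depS // wftE // => /allP dp /andP[lr /allP wp] /=.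
case: (leqP (ln v) (y i)) => //= lt_y; have lt_yi := pr_lt lt_v lt_y.
have yi : y i \in iota 0 (ln v) by rewrite mem_iota.
have {}dp := dp _ yi; have {}wp := wp _ yi; have lt_p := ltn_trans lt_yi lt_v.
case: (leqP (ln v) 2) => h2 /=; rewrite ?orbF; first by apply: IH => //; move: wp; rewrite ltnNge h2 subn0.
case: r lr wp => [|r]; rewrite h2 // subn1 => _ wp; exact: IH.
Qed.

(** Depth and weft are maxima over paths, so exceeding a bound is witnessed by a single walk. [B]
    bounds the fan-ins, so that a digit can name every predecessor. *)
Lemma okwalk_sound B f i r v : 0 < B -> (forall v, v < n -> ln v <= B) -> v < n ->
  ~~ ((dep v <= f) && (wft v <= r)) ->
  exists2 y, (forall j, y j < B) & ~~ okwalk y f i r v.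
Proof.
move=> B0 lnB; elim: f i r v => [|f IH] i r v lt_v.
  rewrite dep0 // => h; exists (fun=> 0) => //=; apply: contra h => ln0.
  by rewrite ln0 wftE // (eqP ln0).
rewrite depS // wftE // andbA [all _ _ && _]andbC -andbA -all_predI negb_and.
case: (leqP _ r) => /= lr; last first.
  have [h2 ->] : 2 < ln v /\ r = 0 by case: leqP lr; lia.
  move=> _; exists (fun=> 0) => //=; rewrite andbF orbF leqn0.
  by case: (ln v) h2 => [|[|[|]]].
move=> /allPn[j]; rewrite mem_iota /= add0n => lt_j viol.
have lt_p := ltn_trans (pr_lt lt_v lt_j) lt_v.
have [y yB yw] := IH i.+1 _ _ lt_p viol.
exists (fun t => if t == i then j else y t) => [t|].
  by case: eqP => // _; apply: leq_trans lt_j (lnB _ lt_v).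
rewrite /= eqxx leqNgt lt_j /=.
have ext r' : okwalk (fun t => if t == i then j else y t) f i.+1 r' (pr v j) =
    okwalk y f i.+1 r' (pr v j).
  by apply: okwalk_ext => t /andP[lt_t _]; rewrite gtn_eqF.
rewrite negb_or !negb_and; move: yw lr; rewrite ext.
case: (leqP (ln v) 2) => h2; rewrite /= ?orbF ?subn0 ?andbT // => yw lr.
by case: r lr yw {viol} => [|r] // _; rewrite subn1 ext.
Qed.
End Circuit.

(** * The evaluation game *)

(** The number of nodes of a complete binary tree. Two subtrees per gate serve every fan-in, as at a
    gate of fan-in larger than 2 y names the one predecessor with which the game goes on. *)
Fixpoint tree_size (f : nat) : nat :=
  if f is f'.+1 then (tree_size f' + tree_size f').+1 else 1.

Section Clause.
Variables (tg ln : nat -> nat) (pr : nat -> nat -> nat) (k : nat).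

(* The digits of y in the interval [q, q + tree_size f) form a strategy of the
   universal player in the game "node v, unrolled to depth f, has value b", and
   [clause] says that "group g chooses node c" defeats this strategy. Digits out
   of range are defeated by every choice. *)
Definition leaf_clause (y : nat -> nat) (g c q v : nat) (b : bool) : bool :=
  if b then (g < k) && (c == v) else (k <= y q) || ((g == y q) && (c != v)).

Fixpoint clause (y : nat -> nat) (g c f q v : nat) (b : bool) : bool :=
  if f is f'.+1 then
    let q1 := q.+1 in let q2 := q.+1 + tree_size f' in
    [|| (tg v == 0) && leaf_clause y g c q v b,
        (tg v == 1) && clause y g c f' q1 (pr v 0) (~~ b),
        (tg v == if b then 2 else 3) &&
          [|| ln v <= y q,
              (y q == 0) && clause y g c f' q1 (pr v 0) b
            | (0 < y q) && clause y g c f' q2 (pr v (y q)) b]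
      | (tg v == if b then 3 else 2) &&
          if ln v <= 2 then
            clause y g c f' q1 (pr v 0) b ||
            ((1 < ln v) && clause y g c f' q2 (pr v 1) b)
          else
            [|| ln v <= y q,
                [&& g == k + q, c < ln v & c != y q]
              | clause y g c f' q1 (pr v (y q)) b]]
  else leaf_clause y g c q v b.

Lemma tree_size_gt0 f : 0 < tree_size f. Proof. by case: f. Qed.

Lemma clause_ext y y' g c f q v b :
  (forall i, q <= i < q + tree_size f -> y i = y' i) ->
  clause y g c f q v b = clause y' g c f q v b.
Proof.
elim: f q v b => [|f IH] q v b /= yy'.
  by rewrite /leaf_clause yy' // leqnn addn1 ltnS leqnn.
have yq : y q = y' q by apply: yy'; lia.
have h1 i : q.+1 <= i < q.+1 + tree_size f -> y i = y' i.
  by move=> h; apply: yy'; lia.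
have h2 i : q.+1 + tree_size f <= i < q.+1 + tree_size f + tree_size f -> y i = y' i.
  by move=> h; apply: yy'; lia.
by rewrite /leaf_clause yq !(IH _ _ _ h1) !(IH _ _ _ h2).
Qed.

Lemma clauseS y g c f q v b : clause y g c f.+1 q v b =
  [|| (tg v == 0) && leaf_clause y g c q v b,
      (tg v == 1) && clause y g c f q.+1 (pr v 0) (~~ b),
      (tg v == if b then 2 else 3) &&
        [|| ln v <= y q,
            (y q == 0) && clause y g c f q.+1 (pr v 0) b
          | (0 < y q) && clause y g c f (q.+1 + tree_size f) (pr v (y q)) b]
    | (tg v == if b then 3 else 2) &&
        if ln v <= 2 then
          clause y g c f q.+1 (pr v 0) b ||
          ((1 < ln v) && clause y g c f (q.+1 + tree_size f) (pr v 1) b)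
        else
          [|| ln v <= y q,
              [&& g == k + q, c < ln v & c != y q]
            | clause y g c f q.+1 (pr v (y q)) b]].
Proof. by []. Qed.

Lemma clause_input y g c f q v b : tg v = 0 ->
  clause y g c f q v b = leaf_clause y g c q v b.
Proof. by case: f => //= f ->; case: b; rewrite /= !orbF. Qed.

Lemma clause_not y g c f q v b : tg v = 1 ->
  clause y g c f.+1 q v b = clause y g c f q.+1 (pr v 0) (~~ b).
Proof. by move=> /= ->; case: b; rewrite /= !orbF. Qed.

(** All predecessors after the first share the second interval. At fan-in 2 the interval still
    determines the predecessor; below a larger gate of a weft-1 circuit there are no witnesses to be
    told apart. *)
Lemma clause_all y g c f q v b : tg v = (if b then 2 else 3) ->
  clause y g c f.+1 q v b =
  [|| ln v <= y q, (y q == 0) && clause y g c f q.+1 (pr v 0) b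
    | (0 < y q) && clause y g c f (q.+1 + tree_size f) (pr v (y q)) b].
Proof. by move=> /= ->; case: b; rewrite /= ?orbF. Qed.

(** The test [c < ln v] keeps a choice that is not the index of a predecessor from passing for a
    witness. *)
Lemma clause_has y g c f q v b : tg v = (if b then 3 else 2) ->
  clause y g c f.+1 q v b =
  if ln v <= 2 then
    clause y g c f q.+1 (pr v 0) b ||
    ((1 < ln v) && clause y g c f (q.+1 + tree_size f) (pr v 1) b)
  else
    [|| ln v <= y q, [&& g == k + q, c < ln v & c != y q]
      | clause y g c f q.+1 (pr v (y q)) b].
Proof. by move=> /= ->; case: b; rewrite /= ?orbF. Qed.

End Clause.

Arguments clause : simpl never.

Section Game.
Variables (tg ln : nat -> nat) (pr : nat -> nat -> nat) (C : circuit).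
Hypotheses (repC : represents tg ln pr C) (wfC : wf_circuit C).
Variables (a : nat -> bool) (k : nat).
Let n := size C.
Let val := nth false (labels (gate_value a) C).
Let dep := nth 0 (labels gate_depth C).
Let wft := nth 0 (labels gate_weft C).
Local Notation clause := (clause tg ln pr k).

(* The first k groups choose the inputs that are set to true. *)
Definition selects (h : nat -> nat) : Prop :=
  forall v, v < n -> tg v = 0 -> a v = has (fun g => h g == v) (iota 0 k).

(** The last two cases are sorted by the player who moves when value [b] is claimed: first the
    universal, then the existential one. *)
Lemma tgP b v : v < n -> [\/ tg v = 0, tg v = 1, tg v = (if b then 2 else 3)
  | tg v = if b then 3 else 2].
Proof.
move=> /(tg_le3 repC); case: (tg v) => [|[|[|[|]]]] //; case: b => _;
  by [constructor 1 | constructor 2 | constructor 3 | constructor 4].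
Qed.

Lemma dep_input v : v < n -> dep v <= 0 -> tg v = 0.
Proof.
move=> lt_v; rewrite (dep0 repC wfC) // => /eqP ln0.
by case: (eqVneq (tg v) 0) => // /(ln_gt0 repC wfC lt_v); rewrite ln0.
Qed.

Lemma dep_pr f v i : v < n -> dep v <= f.+1 -> i < ln v -> dep (pr v i) <= f.
Proof.
move=> lt_v; rewrite (depS repC wfC) // => /allP h lt_i.
by apply: h; rewrite mem_iota.
Qed.

Lemma wft_pr r v i : v < n -> wft v <= r -> i < ln v ->
  wft (pr v i) <= r - (2 < ln v).
Proof.
move=> lt_v; rewrite (wftE repC wfC) // => /andP[_ /allP h] lt_i.
by apply: h; rewrite mem_iota.
Qed.

Lemma pr_ltn v i : v < n -> i < ln v -> pr v i < n.
Proof. by move=> lt_v lt_i; exact: ltn_trans (pr_lt repC wfC lt_v lt_i) lt_v. Qed.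

(* The two children of a gate own disjoint intervals of digits, so that their
   undefeated strategies combine into one y. *)
Lemma clause_sound B h f q v b : selects h -> 0 < B -> k <= B -> n <= B ->
  v < n -> dep v <= f -> val v != b ->
  exists2 y, (forall i, y i < B) & forall g, ~~ clause y g (h g) f q v b.
Proof.
move=> sel_h B0 kB nB.
have leaf q' v' b' : v' < n -> tg v' = 0 -> val v' != b' ->
    exists2 y, (forall i, y i < B) & forall g, ~~ leaf_clause k y g (h g) q' v' b'.
  move=> lt_v' tg0; rewrite /val (val_input repC) // sel_h //; case: b' => /=.
    rewrite eqb_id => /hasPn sel; exists (fun=> 0) => // g.
    by apply/negP => /andP[ltg]; apply/negP/sel; rewrite mem_iota.
  rewrite eqbF_neg negbK => /hasP[g]; rewrite mem_iota /= => ltg hg.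
  (* Group [g] chose the input, so the strategy names [g]; a leaf reads only one digit. *)
  exists (fun=> g) => [i|g']; first exact: leq_trans kB.
  by rewrite leqNgt ltg /=; case: eqP => // ->; rewrite negbK.
elim: f q v b => [|f IH] q v b lt_v dv nval; first by apply: leaf => //; apply: dep_input.
pose q1 := q.+1; pose q2 := q.+1 + tree_size f.
have lnB i : i < ln v -> i < B.
  by have := ln_le repC wfC lt_v; lia.
have child i q' b' : i < ln v -> val (pr v i) != b' ->
    exists2 y, (forall i, y i < B) & forall g, ~~ clause y g (h g) f q' (pr v i) b'.
  by move=> lt_i; apply: IH; [exact: pr_ltn | exact: dep_pr].
have upd y q' j g v' b' : q < q' ->
  clause (fun t => if t == q then j else y t) g (h g) f q' v' b' = clause y g (h g) f q' v' b'.
  by move=> lt_q; apply: clause_ext => t /andP[le_t _]; rewrite gtn_eqF // (leq_trans lt_q).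
case: (tgP b lt_v) => tgv.
- have [y yB yh] := leaf q _ _ lt_v tgv nval; exists y => // g.
  by rewrite clause_input.
- have ln1 := ln_not repC lt_v tgv.
  have [||y yB yh] := @child 0 q1 (~~ b); rewrite ?ln1 //.
    by move: nval; rewrite /val (val_not repC wfC) //; case: (nth _ _ _); case: (b).
  by exists y => // g; rewrite clause_not.
- move: nval; rewrite /val (val_all repC wfC) // => /allPn[j].
  rewrite mem_iota /= add0n => lt_j nvalj.
  have [y yB yh] := @child j (if j == 0 then q1 else q2) b lt_j nvalj.
  exists (fun t => if t == q then j else y t) => [t|g]; first by case: ifP => // _; apply: lnB.
  rewrite clause_all // eqxx !upd //; last by rewrite ltnS leq_addr.
  rewrite leqNgt lt_j /=.
  by case: j {lt_j nvalj} yh => [|j] /= yh; rewrite ?orbF; apply: yh.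
- move: nval; rewrite /val (val_has repC wfC) // -all_predC => /allP nvals.
  have {}nvals j : j < ln v -> val (pr v j) != b by move=> lt_j; apply: nvals; rewrite mem_iota.
  have ln0 : 0 < ln v by apply: (ln_gt0 repC) => //; rewrite tgv; case: (b).
  have [le2|gt2] := leqP (ln v) 2.
    have [y1 y1B y1h] := @child 0 q1 b ln0 (nvals _ ln0).
    have [y2 y2B y2h] : exists2 y, (forall i, y i < B) &
        forall g, ~~ ((1 < ln v) && clause y g (h g) f q2 (pr v 1) b).
      have [lt1|_] := boolP (1 < ln v); last by exists (fun=> 0).
      exact: child lt1 (nvals _ lt1).
    exists (fun i => if i < q2 then y1 i else y2 i) => [i|g]; first by case: ifP.
    rewrite clause_has // le2 negb_or; apply/andP; split.
      by rewrite (@clause_ext _ _ _ _ _ y1) // => i /andP[_ lt_i]; rewrite lt_i.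
    rewrite (@clause_ext _ _ _ _ _ y2) // => i /andP[le_i _].
    by rewrite ltnNge le_i.
  (* The strategy guesses the witness of the group; a choice out of range covers nothing here, and
     any predecessor will do. *)
  pose j := if h (k + q) < ln v then h (k + q) else 0.
  have lt_j : j < ln v by rewrite /j; case: ifP.
  have [y yB yh] := @child j q1 b lt_j (nvals _ lt_j).
  exists (fun t => if t == q then j else y t) => [t|g]; first by case: ifP => // _; apply: lnB.
  rewrite clause_has // leqNgt gt2 /= eqxx upd // leqNgt lt_j /= negb_or yh andbT.
  by apply/negP => /and3P[/eqP -> lt_h]; rewrite /j lt_h eqxx.
Qed.

Lemma leaf_complete K h q v b y : selects h -> 0 < K -> k <= K ->
  v < n -> tg v = 0 -> val v = b ->
  exists2 g, g < K & leaf_clause k y g (h g) q v b.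
Proof.
move=> sel_h K0 kK lt_v tg0; rewrite /val (val_input repC) // sel_h // => <-; rewrite /leaf_clause.
case: hasP => [[g]|h0] /=.
  rewrite mem_iota add0n /= => ltg /eqP hg; exists g; first exact: leq_trans kK.
  by rewrite hg ltg eqxx.
have [?|lt_y] := leqP k (y q); first by exists 0.
exists (y q); first exact: leq_trans kK.
by rewrite eqxx; apply/eqP => hv; apply: h0; exists (y q); rewrite ?mem_iota ?hv.
Qed.

Lemma clause_all_complete K h f q v b y : 0 < K ->
  v < n -> tg v = (if b then 2 else 3) -> val v = b ->
  (forall i, i < ln v -> val (pr v i) = b ->
     exists2 g, g < K & clause y g (h g) f (if i == 0 then q.+1 else q.+1 + tree_size f) (pr v i) b) ->
  exists2 g, g < K & clause y g (h g) f.+1 q v b.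
Proof.
move=> K0 lt_v tgv /eqP; rewrite /val (val_all repC wfC) // => /allP vals child.
have [le_y|lt_y] := leqP (ln v) (y q); first by exists 0; rewrite ?clause_all ?le_y.
have [|g ltg cg] := child _ lt_y; first by apply/eqP/vals; rewrite mem_iota.
exists g => //; rewrite clause_all // leqNgt lt_y /=.
by case: (y q) cg => [|j] ->; rewrite ?orbT.
Qed.

(** At weft 0 every disjunction has at most two sides, both kept in the source, so the winning side
    is picked after y is known and [h] only has to be right on the input groups. *)
Lemma clause_complete0 K h f q v b y : selects h -> 0 < K -> k <= K ->
  v < n -> dep v <= f -> wft v <= 0 -> val v = b ->
  exists2 g, g < K & clause y g (h g) f q v b.
Proof.
move=> sel_h K0 kK.
elim: f q v b => [|f IH] q v b lt_v dv wv vv.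
  by apply: leaf_complete => //; apply: dep_input.
have child i q' b' : i < ln v -> val (pr v i) = b' ->
    exists2 g, g < K & clause y g (h g) f q' (pr v i) b'.
  move=> lt_i; apply: IH; [exact: pr_ltn | exact: dep_pr |].
  by apply: leq_trans (wft_pr lt_v wv lt_i) _; rewrite leq_subr.
case: (tgP b lt_v) => tgv.
- have [g ltg cg] := leaf_complete q y sel_h K0 kK lt_v tgv vv.
  by exists g; rewrite ?clause_input.
- have ln1 := ln_not repC lt_v tgv.
  have [||g ltg cg] := @child 0 q.+1 (~~ b); rewrite ?ln1 //.
    by rewrite -vv /val (val_not repC wfC a lt_v tgv) negbK.
  by exists g => //; rewrite clause_not.
- by apply: clause_all_complete => // i lt_i; apply: child.
- move/eqP: vv; rewrite /val (val_has repC wfC) // => /hasP[j].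
  rewrite mem_iota /= add0n => lt_j /eqP vj.
  have le2 : ln v <= 2.
    by move: wv; rewrite (wftE repC wfC) // => /andP[]; rewrite leqn0 eqb0 -leqNgt.
  have [g ltg cg] := child j (if j == 0 then q.+1 else q.+1 + tree_size f) b lt_j vj.
  exists g => //; rewrite clause_has // le2.
  case: j lt_j cg {vj} => [|[|j]] lt_j cg; [by rewrite cg | by rewrite lt_j cg orbT |].
  by have := leq_trans lt_j le2.
Qed.

(* A single choice of witnesses, made before y is known, answers every y. *)
Lemma clause_complete K f q v b : k + q + tree_size f <= K ->
  v < n -> dep v <= f -> wft v <= 1 -> val v = b ->
  exists2 w, (forall i, w i < n) & forall h y, selects h ->
    (forall i, q <= i < q + tree_size f -> h (k + i) = w i) ->
    exists2 g, g < K & clause y g (h g) f q v b.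
Proof.
elim: f q v b => [|f IH] q v b leK lt_v dv wv vv; have n0 : 0 < n by apply: leq_ltn_trans lt_v.
  exists (fun=> 0) => // h y sel_h _; apply: leaf_complete => //; last exact: dep_input.
    by move: leK => /=; lia.
  by lia.
rewrite /= in leK.
have child i q' b' : i < ln v -> val (pr v i) = b' -> k + q' + tree_size f <= K ->
    exists2 w, (forall i, w i < n) & forall h y, selects h ->
      (forall i, q' <= i < q' + tree_size f -> h (k + i) = w i) ->
      exists2 g, g < K & clause y g (h g) f q' (pr v i) b'.
  move=> lt_i vi leK'; apply: IH => //; [exact: pr_ltn | exact: dep_pr |].
  by apply: leq_trans (wft_pr lt_v wv lt_i) _; rewrite leq_subr.
have child0 h i q' b' y : 2 < ln v -> selects h -> i < ln v -> val (pr v i) = b' ->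
    exists2 g, g < K & clause y g (h g) f q' (pr v i) b'.
  move=> gt2 sel_h lt_i; apply: clause_complete0 => //; [lia|lia|exact: pr_ltn|exact: dep_pr|].
  by apply: leq_trans (wft_pr lt_v wv lt_i) _; rewrite gt2.
have [K0 kK] : 0 < K /\ k <= K by lia.
pose q2 := q.+1 + tree_size f.
case: (tgP b lt_v) => tgv.
- exists (fun=> 0) => // h y sel_h _.
  have [g ltg cg] := leaf_complete q y sel_h K0 kK lt_v tgv vv.
  by exists g; rewrite ?clause_input.
- have ln1 := ln_not repC lt_v tgv.
  have [|||w wB wh] := @child 0 q.+1 (~~ b); rewrite ?ln1 //; [|lia|].
    by rewrite -vv /val (val_not repC wfC a lt_v tgv) negbK.
  exists w => // h y sel_h hw; have [|g ltg cg] := wh h y sel_h.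
    by move=> i hi; apply: hw => /=; lia.
  by exists g => //; rewrite clause_not.
- have [le2|gt2] := leqP (ln v) 2; last first.
    (* Below a large conjunction the weft is 0, so any [w] will do. *)
    exists (fun=> 0) => // h y sel_h _.
    by apply: clause_all_complete => // i; apply: child0.
  have ln0 : 0 < ln v by apply: (ln_gt0 repC) => //; rewrite tgv; case: (b).
  have vals i : i < ln v -> val (pr v i) = b.
    move/eqP: vv; rewrite /val (val_all repC wfC) // => /allP vals lt_i.
    by apply/eqP/vals; rewrite mem_iota.
  have [|w1 w1B w1h] := child 0 q.+1 b ln0 (vals _ ln0); first by lia.
  have [w2 w2B w2h] : exists2 w, (forall i, w i < n) & 1 < ln v -> forall h y, selects h ->
      (forall i, q2 <= i < q2 + tree_size f -> h (k + i) = w i) ->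
      exists2 g, g < K & clause y g (h g) f q2 (pr v 1) b.
    have [lt1|_] := boolP (1 < ln v); last by exists (fun=> 0).
    have [|w wB wh] := child 1 q2 b lt1 (vals _ lt1); first by rewrite /q2; lia.
    by exists w.
  (* The two children read their witnesses at disjoint intervals of positions. *)
  exists (fun i => if i < q2 then w1 i else w2 i) => [i|h y sel_h hw]; first by case: ifP.
  apply: clause_all_complete => // -[|[|i]] lt_i _ /=; last by lia.
    apply: w1h => // i /andP[le_i lt_i2]; rewrite hw ?ifT //=.
    by rewrite /q2 in lt_i2 *; lia.
  apply: w2h => // i /andP[le_i lt_i2]; rewrite hw ?ifF //=.
    by apply/negbTE; rewrite -leqNgt.
  by rewrite /q2 in le_i lt_i2 *; lia.
- move/eqP: (vv); rewrite /val (val_has repC wfC) // => /hasP[j].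
  rewrite mem_iota /= add0n => lt_j /eqP vj.
  have [le2|gt2] := leqP (ln v) 2.
    have [|w wB wh] := child j (if j == 0 then q.+1 else q2) b lt_j vj.
      by case: ifP; rewrite /q2; lia.
    exists w => // h y sel_h hw; have [|g ltg cg] := wh h y sel_h.
      by move=> i hi; apply: hw => /=; move: hi; case: ifP; rewrite /q2; lia.
    exists g => //; rewrite clause_has // le2.
    case: j lt_j cg {vj wh} => [|[|j]] lt_j cg; [by rewrite cg | by rewrite lt_j cg orbT |].
    by have := leq_trans lt_j le2.
  (* Position [q] gets a predecessor with the right value; the later positions are free, as the weft
     below is 0. *)
  exists (fun=> j) => [i|h y sel_h hw].
    by have := ln_le repC wfC lt_v; lia.
  have [le_y|lt_y] := leqP (ln v) (y q).
    by exists 0; rewrite ?clause_has // le_y leqNgt gt2.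
  have [yj|yj] := eqVneq j (y q).
    have [g ltg cg] := child0 h _ q.+1 _ y gt2 sel_h lt_j vj.
    by exists g; rewrite ?clause_has // leqNgt gt2 /= -yj cg !orbT.
  (* A guess different from [j] is covered by the witness group itself. *)
  exists (k + q); first by lia.
  rewrite clause_has // leqNgt gt2 /= hw ?eqxx ?lt_j ?yj ?orbT //=; lia.
Qed.
End Game.

(** * Parsing the encoding of a circuit *)

(* Bank 0 of the machine started on w. *)
Definition cell (w : seq nat) (i : nat) : nat := nth 0 (size w :: w) i.

(** The cells 0, 1 and 2 hold the length, the parameter and the number of gates; each gate has two
    cells before its predecessors. *)
Fixpoint gate_pos (w : seq nat) (j : nat) : nat :=
  if j is j'.+1 then gate_pos w j' + 2 + cell w (gate_pos w j' + 1) else 3.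

(** Makes sense for every word: [n] counts the gates that start inside it, and the last one may
    overshoot. Beyond [n] nothing is known about [P]. *)
Record parsed (w : seq nat) (n : nat) (P : nat -> nat) : Prop := {
  parsed_pos : forall j, j < n -> P j = gate_pos w j;
  parsed_le : forall j, j < n -> gate_pos w j <= size w;
  parsed_gt : size w < gate_pos w n }.

Definition tag_of (w : seq nat) (P : nat -> nat) (v : nat) : nat := cell w (P v).
Definition fanin_of (w : seq nat) (P : nat -> nat) (v : nat) : nat := cell w (P v + 1).
Definition pred_of (w : seq nat) (P : nat -> nat) (v i : nat) : nat := cell w (P v + 2 + i).

Definition wf_word (w : seq nat) (n : nat) : bool :=
  [&& cell w 2 == n, gate_pos w n == (size w).+1 & 0 < n].

(** Well-formedness of all gates is this condition for all triples of digits; the quantifiers are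
    left to the sources, so triples out of range have to pass. *)
Definition wf_at (tg ln : nat -> nat) (pr : nat -> nat -> nat) (n j i i' : nat) : bool :=
  (n <= j) || [&& tg j <= 3, ln j <= n, (tg j != 0) || (ln j == 0),
    (tg j != 1) || (ln j == 1), (tg j == 0) || (0 < ln j),
    (ln j <= i) || (pr j i < j)
    & [|| i' <= i, ln j <= i' | pr j i != pr j i']].

Lemma gate_pos_ge w j : j + 3 <= gate_pos w j.
Proof. by elim: j => //= j; lia. Qed.

Lemma parsed_lt w n P : parsed w n P -> n <= size w.
Proof.
case=> _ le_pos _; case: n le_pos => // n /(_ n (leqnn _)).
by have := gate_pos_ge w n; lia.
Qed.

Lemma cell_encode k C v : v <= size C -> let w := k :: encode_circuit C in
  gate_pos w v = 3 + size (flatten (map encode_gate (take v C))) /\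
  (v < size C -> exists rest, forall t, cell w (gate_pos w v + t) =
     nth 0 (encode_gate (nth Input C v) ++ rest) t).
Proof.
move=> le_v w.
have cellE j t : j < size C ->
    gate_pos w j = 3 + size (flatten (map encode_gate (take j C))) ->
    cell w (gate_pos w j + t) = nth 0 (encode_gate (nth Input C j) ++
      flatten (map encode_gate (drop j.+1 C))) t.
  move=> lt_j ->; rewrite /cell -addnA add3n /= -[X in map _ X](cat_take_drop j C).
  by rewrite map_cat flatten_cat nth_cat ltnNge leq_addr /= addKn (drop_nth Input) //.
elim: v le_v => [|v IH] le_v.
  split; first by rewrite take0.
  by move=> lt_v; eexists => t; apply: cellE; rewrite ?take0.
have [pos_v _] := IH (ltnW le_v).
have pos_Sv : gate_pos w v.+1 = 3 + size (flatten (map encode_gate (take v.+1 C))).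
  rewrite /= cellE // (take_nth Input) // -cats1 map_cat flatten_cat size_cat pos_v /= cats0 /=.
  lia.
by split=> // lt_v; eexists => t; apply: cellE.
Qed.

Lemma encode_parsed k C n P (w := k :: encode_circuit C) : 0 < size C -> parsed w n P ->
  [/\ n = size C, wf_word w n & represents (tag_of w P) (fanin_of w P) (pred_of w P) C].
Proof.
move=> C0 [posP le_pos gt_pos].
have [pos_end _] := cell_encode k (leqnn (size C)).
have {}pos_end : gate_pos w (size C) = (size w).+1.
  by rewrite pos_end take_size /w /encode_circuit /=; lia.
have mono i j : i <= j -> gate_pos w i <= gate_pos w j.
  by move=> /subnKC <-; elim: (j - i) => [|d IH]; rewrite ?addn0 // addnS /=; lia.
(* Positions increase with the index, and gate number [size C] would start just after the word. *)
have nE : n = size C.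
  apply/eqP; rewrite eqn_leq; apply/andP; split; rewrite leqNgt; apply/negP.
    by move=> /le_pos; rewrite pos_end ltnn.
  move=> lt_n; have := mono _ _ lt_n; rewrite pos_end.
  have : gate_pos w n + 2 <= gate_pos w n.+1 by apply: leq_addr.
  by move: gt_pos; lia.
have inner v : v < size C -> exists rest, forall t, cell w (P v + t) =
     nth 0 (encode_gate (nth Input C v) ++ rest) t.
  move=> lt_v; rewrite posP ?nE //.
  exact: (cell_encode k (ltnW lt_v)).2 lt_v.
split=> //.
  by rewrite /wf_word nE pos_end eqxx C0 /cell /= eqxx.
split=> v; rewrite /tag_of /fanin_of /pred_of.
- by move=> /inner[rest h]; rewrite -[P v]addn0 h; case: (nth Input C v).
- by move=> /inner[rest h]; rewrite h.
- move=> i /inner[rest h]; rewrite -addnA !h /= nth_cat => lt_i.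
  by rewrite lt_i.
Qed.

Definition decode_gate (tg ln : nat -> nat) (pr : nat -> nat -> nat) (v : nat) : gate :=
  match tg v with
  | 0 => Input
  | 1 => Not (pr v 0)
  | 2 => And (mkseq (pr v) (ln v))
  | _ => Or (mkseq (pr v) (ln v))
  end.

Lemma cells_word k x : 0 < size x ->
  cell (k :: x) 2 :: map (cell (k :: x)) (iota 3 (size x).-1) = x.
Proof.
case: x => //= x0 x _; rewrite /cell /=; congr cons.
by rewrite -[3]addn0 iotaDl -map_comp -[RHS](mkseq_nth 0).
Qed.

Lemma parsed_encode k x n P B (w := k :: x) : parsed w n P -> wf_word w n -> n < B ->
  (forall j i i', j < B -> i < B -> i' < B ->
     wf_at (tag_of w P) (fanin_of w P) (pred_of w P) n j i i') ->
  exists2 C, x = encode_circuit C & wf_circuit C.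
Proof.
move=> parsedP /and3P[/eqP cell2 /eqP pos_n n0] ltB wfP.
have [posP le_pos _] := parsedP.
set tg := tag_of w P in wfP; set ln := fanin_of w P in wfP; set pr := pred_of w P in wfP.
have B0 : 0 < B by apply: leq_ltn_trans ltB.
have wf0 j : j < n -> [/\ tg j <= 3, ln j <= n, tg j = 0 -> ln j = 0,
    tg j = 1 -> ln j = 1 & tg j != 0 -> 0 < ln j].
  move=> lt_j; have := wfP j 0 0 (ltn_trans lt_j ltB) B0 B0.
  rewrite /wf_at leqNgt lt_j /= => /and5P[-> -> h0 h1 /andP[h2 _]].
  by split=> // h; [move: h0|move: h1|move: h2]; rewrite ?h ?(negbTE h) //= => /eqP.
have pr_lt j i : j < n -> i < ln j -> pr j i < j.
  move=> lt_j lt_i; have [_ le_ln _ _ _] := wf0 j lt_j.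
  (* With last digit 0 the distinctness condition is void. *)
  have := wfP j i 0 (ltn_trans lt_j ltB) (leq_trans lt_i (leq_trans le_ln (ltnW ltB))) B0.
  rewrite /wf_at leqNgt lt_j /= => /and5P[_ _ _ _ /and3P[_ + _]].
  by rewrite leqNgt lt_i.
have pr_neq j i i' : j < n -> i < i' < ln j -> pr j i != pr j i'.
  move=> lt_j /andP[lt_i lt_i']; have [_ le_ln _ _ _] := wf0 j lt_j.
  have i'B := leq_trans lt_i' (leq_trans le_ln (ltnW ltB)).
  have := wfP j i i' (ltn_trans lt_j ltB) (ltn_trans lt_i i'B) i'B.
  rewrite /wf_at leqNgt lt_j /= => /and5P[_ _ _ _ /and3P[_ _]].
  by rewrite leqNgt lt_i leqNgt lt_i'.
pose C := mkseq (decode_gate tg ln pr) n.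
have encE j : j < n -> encode_gate (decode_gate tg ln pr j) =
    map (cell w) (iota (gate_pos w j) (2 + ln j)).
  move=> lt_j; have [tg3 _ ln0 ln1 _] := wf0 j lt_j.
  have predsE m : mkseq (pr j) m = map (cell w) (iota (gate_pos w j).+2 m).
    rewrite -[_.+2]addn0 iotaDl -map_comp; apply: eq_map => i /=.
    by rewrite /pr /pred_of posP // addn2.
  have -> : map (cell w) (iota (gate_pos w j) (2 + ln j)) =
      [:: tg j, ln j & mkseq (pr j) (ln j)].
    by rewrite predsE /= /tg /ln /tag_of /fanin_of posP // addn1.
  rewrite /decode_gate /encode_gate; move: tg3 ln0 ln1.
  case: (tg j) => [|[|[|[|]]]] //= _.
  - by move=> ->.
  - by move=> _ ->.
  - by rewrite size_mkseq.
  - by rewrite size_mkseq.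
have pos_ge3 i : 3 <= gate_pos w i by elim: i => //= i; lia.
have encC j : j <= n -> flatten (map encode_gate (mkseq (decode_gate tg ln pr) j)) =
    map (cell w) (iota 3 (gate_pos w j - 3)).
  elim: j => // j IH lt_j; rewrite mkseqS map_rcons flatten_rcons IH 1?ltnW // encE //.
  rewrite -map_cat; have -> : gate_pos w j.+1 - 3 = gate_pos w j - 3 + (2 + ln j).
    by rewrite /= /ln /fanin_of posP //; have := pos_ge3 j; lia.
  by rewrite [in RHS]iotaD subnKC.
have pos_ge5 i : 0 < i -> 5 <= gate_pos w i.
  by case: i => // i _ /=; have := pos_ge3 i; lia.
have szx : 0 < size x by have := pos_ge5 n n0; rewrite pos_n /=; lia.
exists C.
  rewrite /encode_circuit size_mkseq encC // pos_n -cell2.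
  rewrite /= subSS subSS subn1.
  exact/esym/cells_word.
apply/andP; split; first by rewrite size_mkseq.
apply/forallP => -[j]; rewrite size_mkseq /= => lt_j.
have [tg3 _ ln0 ln1 ln2] := wf0 j lt_j.
have uniq_preds : uniq (mkseq (pr j) (ln j)).
  apply/mkseq_uniqP => i i'; rewrite !inE => lt_i lt_i' eq_pr.
  case: (ltngtP i i') => // lt_ii.
    by have := pr_neq j i i' lt_j; rewrite lt_ii lt_i' eq_pr eqxx => /(_ isT).
  by have := pr_neq j i' i lt_j; rewrite lt_ii lt_i eq_pr eqxx => /(_ isT).
have all_preds : all (fun i => i < j) (mkseq (pr j) (ln j)).
  by apply/allP => _ /mapP[i + ->]; rewrite mem_iota => lt_i; apply: pr_lt.
rewrite nth_mkseq // /wf_gate /decode_gate.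
case: (tg j) tg3 ln1 ln2 => [|[|[|[|]]]] //= _.
- by move=> ln1 _; rewrite pr_lt // ln1.
- by move=> _ /(_ isT) ln2; rewrite all_preds uniq_preds; case: (ln j) ln2.
- by move=> _ /(_ isT) ln2; rewrite all_preds uniq_preds; case: (ln j) ln2.
Qed.

(** * The covering instance *)

(** The lexicographic order is that of nested loops, so indices agree with the order in which the
    machine visits the vectors. *)
Fixpoint vects (B m : nat) : seq (seq nat) :=
  if m is m'.+1 then [seq x :: v | x <- iota 0 B, v <- vects B m'] else [:: [::]].

Lemma size_vects B m : size (vects B m) = B ^ m.
Proof. by elim: m => //= m IH; rewrite size_allpairs size_iota IH expnS. Qed.

Lemma mem_vects B m y : (y \in vects B m) = (size y == m) && all (fun i => i < B) y.
Proof.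
elim: m y => [|m IH] y; first by case: y.
apply/allpairsP/idP => /= [[[x v] [+ + ->]]|].
  by rewrite mem_iota IH /= => -> /andP[/eqP -> ->]; rewrite eqxx.
case: y => //= x v /and3P[sz lt_x vB]; exists (x, v).
by rewrite /= mem_iota IH lt_x vB !andbT; split.
Qed.

Lemma uniq_vects B m : uniq (vects B m).
Proof.
elim: m => //= m IH; apply: allpairs_uniq => //; first exact: iota_uniq.
by move=> [x y] [x' y'] _ _ /= [-> ->].
Qed.

Lemma mkseq_vects B m y : (forall i, y i < B) -> mkseq y m \in vects B m.
Proof.
by move=> yB; rewrite mem_vects size_mkseq eqxx all_map; apply/allP => i _ /=.
Qed.

Section Instance.
Variables (d k n : nat) (tg ln : nat -> nat) (pr : nat -> nat -> nat) (wf : bool).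

(** Digit 0 gives the kind of a source and the tree starts at digit 1, so the witness groups go up
    to [k + tree_size d]. *)
Definition num_groups : nat := k + (tree_size d).+1.
Definition num_digits : nat := tree_size d + 4.
(** One radix for all digits: it exceeds every node, every group, and the kinds 0, 1 and 2. *)
Definition radix : nat := n + num_groups + 3.

(* The first digit of y distinguishes circuit clauses, the clauses by which every
   group chooses a node, and those by which the first k groups choose distinct
   nodes. The first three conjuncts do not depend on (g, c): if one of them fails
   then y cannot be covered at all. *)
Definition covers (y : nat -> nat) (g c : nat) : bool :=
  [&& wf, wf_at tg ln pr n (y 1) (y 2) (y 3), okwalk ln pr y d 1 1 n.-1
    & [|| (y 0 == 0) && clause tg ln pr k y g c d 1 n.-1 true,
          (y 0 == 1) && ((num_groups <= y 1) ||
             [&& g == y 1, c < n & (k <= g) || (tg c == 0)]),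
          (y 0 == 2) && [|| k <= y 2, y 2 <= y 1
             | ((g == y 1) || (g == y 2)) && (c != y 3)]
        | 2 < y 0]].

Let K := num_groups.
Let m := num_digits.
Let B := radix.

Lemma covers_ext y y' g c : (forall i, i < m -> y i = y' i) ->
  covers y g c = covers y' g c.
Proof.
rewrite /m /num_digits => yy'.
have tree_ge f : f < tree_size f by elim: f => //= f; lia.
have := tree_ge d => lt_d.
have e i : i < 4 -> y i = y' i by move=> lt_i; apply: yy'; lia.
rewrite /covers !e // (@okwalk_ext _ _ y y') => [|i hi]; last by apply: yy'; lia.
by rewrite (@clause_ext _ _ _ _ y y') // => i hi; apply: yy'; lia.
Qed.

Definition instance_rel (j u : nat) : bool :=
  let v := nth [::] (vects B 2) u in
  covers (nth 0 (nth [::] (vects B m) j)) (nth 0 v 0) (nth 0 v 1).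

Definition answers (h : nat -> nat) : Prop :=
  forall y, (forall i, y i < B) -> exists2 g, g < K & covers y g (h g).

Lemma radix_gt : [/\ n < B, K < B & 2 < B].
Proof. by rewrite /B /radix /K; split; lia. Qed.

Let idx g c := index [:: g; c] (vects B 2).

Lemma idx_lt g c : g < B -> c < B -> idx g c < B ^ 2.
Proof. by move=> gB cB; rewrite -size_vects index_mem mem_vects /= gB cB. Qed.

Lemma nth_idx g c : g < B -> c < B -> nth [::] (vects B 2) (idx g c) = [:: g; c].
Proof. by move=> gB cB; rewrite nth_index // mem_vects /= gB cB. Qed.

(** A sink records its group along with the node, so there are exactly [K] sinks even if groups
    agree on a node. *)
Lemma answers_cover h : (forall g, g < K -> h g < n) -> answers h ->
  exists X : seq nat,
    [/\ uniq X, size X = K, all (fun v => v < B ^ 2 + B ^ m) X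
      & forall j, j < B ^ m ->
          (B ^ 2 + j \in X) || has (fun u => (u < B ^ 2) && instance_rel j u) X].
Proof.
have [nB KB B2] := radix_gt.
move=> hn ans; have inB g : g < K -> g < B /\ h g < B.
  by move=> gK; have := hn g gK; lia.
exists [seq idx g (h g) | g <- iota 0 K]; split.
- rewrite map_inj_in_uniq ?iota_uniq // => g g'; rewrite !mem_iota /= => gK gK' eq_idx.
  have [gB hB] := inB g gK; have [g'B hB'] := inB g' gK'.
  by have := nth_idx gB hB; rewrite eq_idx nth_idx // => -[].
- by rewrite size_map size_iota.
- apply/allP => _ /mapP[g + ->]; rewrite mem_iota /= => gK.
  by have [? ?] := inB g gK; apply: ltn_addr; apply: idx_lt.
- move=> j lt_j; set y := nth [::] (vects B m) j.
  have : y \in vects B m by rewrite mem_nth ?size_vects.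
  rewrite mem_vects => /andP[_ /all_nthP yB].
  have [i|g gK cg] := ans (nth 0 y).
    have [lt_i|le_i] := ltnP i (size y); first exact: yB.
    by rewrite nth_default //; lia.
  have [gB hB] := inB g gK.
  apply/orP; right; apply/hasP; exists (idx g (h g)).
    by apply/mapP; exists g; rewrite ?mem_iota.
  by rewrite idx_lt // /instance_rel nth_idx.
Qed.

(* The clause of group g does not use digit 2, so it has radix > K copies, which
   cannot all be sinks: each group makes a choice, and this exhausts the sinks. *)
Lemma cover_answers X :
  uniq X -> size X = K ->
  (forall j, j < B ^ m ->
     (B ^ 2 + j \in X) || has (fun u => (u < B ^ 2) && instance_rel j u) X) ->
  exists2 h, (forall g, g < K -> h g < n) & answers h.
Proof.
have [nB KB B2] := radix_gt.
move=> uniqX sizeX covX.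
have cov y : (forall i, y i < B) -> B ^ 2 + index (mkseq y m) (vects B m) \in X \/
    exists g c, [/\ g < B, c < B, idx g c \in X & covers y g c].
  move=> yB; have := covX (index (mkseq y m) (vects B m)).
  rewrite -[B ^ m]size_vects index_mem mkseq_vects // => /(_ isT) /orP[]; first by left.
  case/hasP=> u uX /andP[lt_u]; rewrite /instance_rel nth_index ?mkseq_vects // => cu; right.
  have : nth [::] (vects B 2) u \in vects B 2 by rewrite mem_nth ?size_vects.
  rewrite mem_vects; move: cu.
  case eq_u: (nth [::] (vects B 2) u) => [|g [|c [|? ?]]] //= cu /and3P[gB cB _].
  exists g, c; split=> //.
    by rewrite /idx -eq_u index_uniq ?uniq_vects ?size_vects.
  by move: cu; rewrite (@covers_ext _ y) // => i lt_i; rewrite nth_mkseq.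
have choice g : g < K -> has (fun c => idx g c \in X) (iota 0 n).
  move=> gK; apply/negPn/negP => /hasPn none.
  pose y t i := match i with 0 => 1 | 1 => g | 2 => t | _ => 0 end.
  have yB t i : t < B -> y t i < B by case: i => [|[|[|]]] //=; lia.
  have copies t : t < B -> B ^ 2 + index (mkseq (y t) m) (vects B m) \in X.
    move=> tB; case: (cov (y t)) => [i|//|[g' [c [g'B cB idxX]]]]; first exact: yB.
    rewrite /covers /= leqNgt gK /= => /and4P[_ _ _ /orP[/and3P[/eqP gg' cn _]|//]].
    by have := none c; rewrite mem_iota cn -gg' idxX => /(_ isT).
  have : size [seq B ^ 2 + index (mkseq (y t) m) (vects B m) | t <- iota 0 B] <= size X.
    apply: uniq_leq_size => [|_ /mapP[t + ->]]; last by rewrite mem_iota /= => /copies.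
    rewrite map_inj_in_uniq ?iota_uniq // => t t'; rewrite !mem_iota /= => tB t'B /addnI eq_idx.
    have : mkseq (y t) m = mkseq (y t') m.
      rewrite -[LHS](nth_index [::] (mkseq_vects m (yB t ^~ tB))) eq_idx nth_index //.
      by apply: mkseq_vects => i; apply: yB.
    by move=> /(congr1 (nth 0 ^~ 2)); rewrite !nth_mkseq //; rewrite /m /num_digits; lia.
  by rewrite size_map size_iota sizeX; lia.
pose h g := find (fun c => idx g c \in X) (iota 0 n).
have hn g : g < K -> h g < n by move=> /choice; rewrite has_find size_iota.
have hX g : g < K -> idx g (h g) \in X.
  by move=> gK; have := nth_find 0 (choice g gK); rewrite nth_iota ?hn.
exists h => // y yB.
(* These are [K] distinct members of [X], which has only [K]. *)
have EX : [seq idx g (h g) | g <- iota 0 K] =i X.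
  apply: (uniq_min_size _ _ _).2; last by rewrite sizeX size_map size_iota.
    rewrite map_inj_in_uniq ?iota_uniq // => g g'; rewrite !mem_iota /= => gK gK' eq_idx.
    have gB := ltn_trans gK KB; have g'B := ltn_trans gK' KB.
    have := nth_idx gB (ltn_trans (hn g gK) nB).
    by rewrite eq_idx nth_idx // ?(ltn_trans (hn g' gK') nB) // => -[].
  by move=> _ /mapP[g + ->]; rewrite mem_iota => /hX.
case: (cov y yB) => [|[g [c [gB cB]]]]; rewrite -EX => /mapP[g']; rewrite mem_iota /= => gK.
  by have := idx_lt (ltn_trans gK KB) (ltn_trans (hn g' gK) nB); lia.
move=> eq_idx; have := nth_idx gB cB.
rewrite eq_idx nth_idx ?(ltn_trans gK KB) ?(ltn_trans (hn g' gK) nB) // => -[<- <-].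
by exists g'.
Qed.
End Instance.

(** * Satisfying assignments and choices of the groups *)

Section Equivalence.
Variables (d k n : nat) (x : seq nat) (P : nat -> nat).
Let w := k :: x.
Hypothesis parsedP : parsed w n P.
Let tg := tag_of w P.
Let ln := fanin_of w P.
Let pr := pred_of w P.
Let K := num_groups d k.
Let B := radix d k n.

Lemma weightE C a : represents tg ln pr C ->
  weight C a = size [seq i <- iota 0 (size C) | (tg i == 0) && a i].
Proof.
move=> repC; rewrite /weight.
rewrite (eq_bigr (fun j : 'I_(size C) => ((tg j == 0) && a j : nat))) => [|j _].
  rewrite -(big_mkord xpredT (fun j => ((tg j == 0) && a j : nat))).
  rewrite size_filter -sum1_count [RHS]big_mkcond /index_iota subn0.
  by apply: eq_bigr => j _; case: (_ && _).
rewrite (tgE repC) // (set_nth_default Input) //.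
by case: (nth Input C j).
Qed.

(** The first [k] groups list the true inputs, and the others take their witnesses from
    [clause_complete]. *)
Lemma circuit_answers : WCS 1 d x k ->
  exists2 h, (forall g, g < K -> h g < n) & answers d k n tg ln pr (wf_word w n) h.
Proof.
move=> [C [xE wfC weftC depthC [a sat wt]]].
have C0 : 0 < size C by case/andP: wfC.
have parsedC : parsed (k :: encode_circuit C) n P by rewrite -xE.
have := encode_parsed C0 parsedC; rewrite -xE -/w => -[nE wfw]; rewrite -/tg -/ln -/pr => repC.
have lt_out : n.-1 < size C by rewrite nE prednK.
rewrite depthE // -nE in depthC; rewrite weftE // -nE in weftC; rewrite satisfiesE // -nE in sat.
have leK : k + 1 + tree_size d <= K by rewrite /K /num_groups; lia.
have [wit witB witP] := clause_complete repC wfC leK lt_out depthC weftC sat.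
pose S := [seq i <- iota 0 n | (tg i == 0) && a i].
have sizeS : size S = k by rewrite /S nE -weightE.
have S_P g : g < k -> [/\ nth 0 S g < n, tg (nth 0 S g) = 0 & a (nth 0 S g)].
  move=> lt_g; have : nth 0 S g \in S by rewrite mem_nth ?sizeS.
  by rewrite mem_filter mem_iota add0n /= => /andP[/andP[/eqP ? ?] ?].
pose h g := if g < k then nth 0 S g else wit (g - k).
have hn g : h g < n.
  by rewrite /h; case: ifP => [/S_P[]//|_]; rewrite nE; apply: witB.
have sel_h : selects tg C a k h.
  move=> v; rewrite -nE => lt_v tg0; apply/idP/hasP => [av|[g]].
    have vS : v \in S by rewrite mem_filter tg0 av mem_iota.
    have lt_v' : index v S < k by rewrite -sizeS index_mem.
    exists (index v S); first by rewrite mem_iota.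
    by rewrite /h lt_v' nth_index.
  by rewrite mem_iota /= => lt_g; rewrite /h lt_g => /eqP <-; have [] := S_P g lt_g.
exists h => // y yB.
have wf_y : wf_at tg ln pr n (y 1) (y 2) (y 3).
  rewrite /wf_at; case: (leqP n (y 1)) => //= lt_1; rewrite nE in lt_1.
  have -> : ln (y 1) <= n by have := ln_le repC wfC lt_1; lia.
  rewrite (tg_le3 repC) //=.
  have -> : (tg (y 1) != 0) || (ln (y 1) == 0).
    by have [/(ln_input repC lt_1)->|] := eqVneq (tg (y 1)) 0.
  have -> : (tg (y 1) != 1) || (ln (y 1) == 1).
    by have [/(ln_not repC lt_1)->|] := eqVneq (tg (y 1)) 1.
  have -> : (tg (y 1) == 0) || (0 < ln (y 1)).
    by have [|/(ln_gt0 repC wfC lt_1)] := eqVneq (tg (y 1)) 0.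
  have -> /= : (ln (y 1) <= y 2) || (pr (y 1) (y 2) < y 1).
    by case: (leqP (ln (y 1)) (y 2)) => //= /(pr_lt repC wfC lt_1).
  case: (leqP (y 3) (y 2)) => //= lt_23; case: (leqP (ln (y 1)) (y 3)) => //= lt_3.
  have lt_2 := ltn_trans lt_23 lt_3; have [szE le_3] := (lnE repC lt_1, lt_3).
  have /and3P[_ uniq_p _] := wf_gate_at wfC lt_1.
  by rewrite !(prE repC) // nth_uniq -?szE // ltn_eqF.
rewrite /covers wfw wf_y (okwalk_complete repC wfC) //=.
have K0 : 0 < num_groups d k by rewrite /num_groups addnS.
case: (ltngtP (y 0) 1) => [y0|y1|y1]; first last.
- rewrite y1 /=.
  have [le_K|lt_K] := leqP (num_groups d k) (y 1); first by exists 0.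
  exists (y 1) => //; rewrite eqxx hn /= orbF.
  have [//|lt_k] := leqP k (y 1).
  by rewrite /h lt_k; have [_ -> _] := S_P _ lt_k.
- have [y2|y2] := eqVneq (y 0) 2; last first.
    have gt2 : 2 < y 0 by lia.
    by exists 0; rewrite // gt2 !orbT.
  rewrite y2 /=.
  have [le_k|lt_k] := leqP k (y 2); first by exists 0.
  have [le_12|lt_12] := leqP (y 2) (y 1); first by exists 0.
  have hneq : h (y 1) != h (y 2).
    rewrite /h lt_k (ltn_trans lt_12 lt_k) nth_uniq ?sizeS ?(ltn_trans lt_12) //.
      by rewrite ltn_eqF.
    by rewrite filter_uniq ?iota_uniq.
  have [h1|h1] := eqVneq (h (y 1)) (y 3).
    exists (y 2); first by rewrite /num_groups ltn_addr.
    by rewrite eqxx orbT -h1 eq_sym hneq.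
  exists (y 1); first by rewrite /num_groups ltn_addr // (ltn_trans lt_12).
  by rewrite eqxx h1.
have {}y0 : y 0 = 0 by case: (y 0) y0.
rewrite y0 /=.
have [|g ltg cg] := witP h y sel_h.
  by move=> i _; rewrite /h ltnNge leq_addr /= addKn.
by exists g; rewrite ?cg.
Qed.

(** Each property is extracted by exhibiting a source that can be covered only if the property
    holds. The true inputs are those chosen by the first [k] groups. *)
Lemma answers_circuit h : (forall g, g < K -> h g < n) ->
  answers d k n tg ln pr (wf_word w n) h -> WCS 1 d x k.
Proof.
move=> hn ans; have [nB KB B2] := radix_gt d k n.
have K0 : 0 < K by rewrite /K /num_groups addnS.
have yB s i : all (fun v => v < B) s -> nth 0 s i < B.
  move=> /all_nthP sB; have [lt_i|le_i] := ltnP i (size s); first exact: sB.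
  by rewrite nth_default // /B; lia.
have wfw : wf_word w n.
  have [|g _ /andP[]//] := ans (fun=> 0).
  by move=> _; rewrite -/B; lia.
have wf_atP j i i' : j < B -> i < B -> i' < B -> wf_at tg ln pr n j i i'.
  move=> jB iB i'B; have [t|g _ /and4P[]//] := ans (nth 0 [:: 0; j; i; i']).
  by apply: yB; rewrite /= jB iB i'B andbT; rewrite /B; lia.
have [C xE wfC] := parsed_encode parsedP wfw nB wf_atP.
have C0 : 0 < size C by case/andP: wfC.
have parsedC : parsed (k :: encode_circuit C) n P by rewrite -xE.
have := encode_parsed C0 parsedC; rewrite -xE -/w => -[nE _]; rewrite -/tg -/ln -/pr => repC.
have lt_out : n.-1 < size C by rewrite nE prednK.
pose a v := has (fun g => h g == v) (iota 0 k).
have sel_h : selects tg C a k h by [].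
have kK : k < K by rewrite /K /num_groups addnS ltnS leq_addr.
have dw : (nth 0 (labels gate_depth C) n.-1 <= d) && (nth 0 (labels gate_weft C) n.-1 <= 1).
  apply/negPn/negP => viol.
  have [||y y_B /negP[]] := okwalk_sound repC wfC (B := B) 1 _ _ lt_out viol.
  - by rewrite /B; lia.
  - by move=> v lt_v; have := ln_le repC wfC lt_v; rewrite -nE in lt_v; rewrite /B; lia.
  by have [|g _ /and4P[]//] := ans y.
case/andP: dw => dC wC.
have satC : satisfies C a.
  rewrite satisfiesE // -nE; apply/negPn/negP => nsat.
  have [||||y y_B nclause] := clause_sound repC wfC 1 sel_h (B := B) _ _ _ lt_out dC (b := true) _.
  - by rewrite /B; lia.
  - by rewrite /B; lia.
  - by rewrite -nE /B; lia.
  - by rewrite eqb_id.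
  (* Setting digit 0 selects the circuit clause and does not affect the game, which starts at digit
     1. *)
  have [i|g _] := ans (fun i => if i == 0 then 0 else y i); first by case: ifP => // _; rewrite /B; lia.
  rewrite /covers /= => /and4P[_ _ _]; rewrite orbF => cg.
  have /negP[] := nclause g.
  by rewrite (clause_ext _ _ _ _ _ _ (y' := fun i => if i == 0 then 0 else y i)) // => -[].
have h_input g : g < k -> tg (h g) = 0.
  move=> lt_g; have lt_gK := ltn_trans lt_g kK.
  have [i|g' _] := ans (nth 0 [:: 1; g]).
    by apply: yB; rewrite /= andbT /B; lia.
  rewrite /covers /= => /and4P[_ _ _]; rewrite orbF leqNgt lt_gK /=.
  by case/and3P=> [/eqP -> _]; rewrite leqNgt lt_g => /eqP.
have h_inj g g' : g < g' < k -> h g != h g'.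
  move=> /andP[lt_g lt_g']; apply/eqP => eq_h.
  have hB : h g < B by apply: ltn_trans nB; apply: hn; lia.
  (* Digit 3 is the node on which both groups are supposed to agree, so neither could cover this
     source. *)
  have [i|g'' _] := ans (nth 0 [:: 2; g; g'; h g]).
    by apply: yB; rewrite /= hB andbT /B; lia.
  rewrite /covers /= => /and4P[_ _ _]; rewrite orbF leqNgt lt_g' leqNgt lt_g /=.
  by case/andP=> /orP[] /eqP ->; rewrite ?eq_h eqxx.
exists C; split=> //; rewrite ?weftE ?depthE // -?nE //; exists a => //.
(* The first [k] groups list the true inputs without repetition, so the weight is exactly [k]. *)
rewrite (weightE _ repC) -[RHS](size_iota 0) -[RHS](size_map h); apply: perm_size.
apply: uniq_perm; first by rewrite filter_uniq ?iota_uniq.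
  rewrite map_inj_in_uniq ?iota_uniq // => g g'; rewrite !mem_iota /= => lt_g lt_g' eq_h.
  case: (ltngtP g g') => // lt_gg.
    by have := h_inj g g'; rewrite lt_gg lt_g' eq_h eqxx => /(_ isT).
  by have := h_inj g' g; rewrite lt_gg lt_g eq_h eqxx => /(_ isT).
move=> v; rewrite mem_filter mem_iota /= -nE; apply/idP/mapP.
  by case/andP=> [/andP[_ /hasP[g gk /eqP <-]] _]; exists g.
case=> g; rewrite mem_iota /= => lt_g ->.
rewrite h_input // hn ?(ltn_trans lt_g) // andbT; apply/hasP; exists g => //.
by rewrite mem_iota.
Qed.
End Equivalence.

(** * Evaluating the covering relation by one expression *)

(** Truth is being nonzero: addition is then disjunction, and truncated subtraction yields negation
    and comparison. *)
Definition holds (s : state) (e : expr) : bool := value s e != 0.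

Definition eNot e := Sub (Cst 1) e.
Definition eOr e f := Add e f.
Definition eAnd e f := eNot (eOr (eNot e) (eNot f)).
Definition eLt e f := Sub f e.
Definition eLe e f := eNot (eLt f e).
Definition eEq e f := eAnd (eLe e f) (eLe f e).
Definition eNeq e f := eNot (eEq e f).

Lemma holds_not s e : holds s (eNot e) = ~~ holds s e.
Proof. by rewrite /holds /=; case: (value s e) => [|[|]]. Qed.

Lemma holds_or s e f : holds s (eOr e f) = holds s e || holds s f.
Proof. by rewrite /holds /= addn_eq0 negb_and. Qed.

Lemma holds_and s e f : holds s (eAnd e f) = holds s e && holds s f.
Proof. by rewrite holds_not holds_or !holds_not negb_or !negbK. Qed.

Lemma holds_lt s e f : holds s (eLt e f) = (value s e < value s f).
Proof. by rewrite /holds /= subn_eq0 -ltnNge. Qed.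

Lemma holds_le s e f : holds s (eLe e f) = (value s e <= value s f).
Proof. by rewrite holds_not holds_lt -leqNgt. Qed.

Lemma holds_eq s e f : holds s (eEq e f) = (value s e == value s f).
Proof. by rewrite holds_and !holds_le eqn_leq. Qed.

Lemma holds_neq s e f : holds s (eNeq e f) = (value s e != value s f).
Proof. by rewrite holds_not holds_eq. Qed.

Lemma holds_bool s (b : bool) : holds s (Cst b) = b.
Proof. by case: b. Qed.

Definition holdsE :=
  (holds_neq, holds_eq, holds_le, holds_lt, holds_and, holds_or, holds_not, holds_bool).

(* Bank 0 holds the input, bank 1 the positions of the gates, bank 2 the digits
   of y, followed by g and c; the number of gates and the position after the
   last gate are in bank 3. *)
Definition eTag v := Cell 0 (Cell 1 v).
Definition eFanin v := Cell 0 (Add (Cell 1 v) (Cst 1)).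
Definition ePred v i := Cell 0 (Add (Add (Cell 1 v) (Cst 2)) i).
Definition eK := Cell 0 (Cst 1).
Definition eN := Cell 3 (Cst 0).
Definition ePos := Cell 3 (Cst 1).
Definition eOut := Sub eN (Cst 1).
Definition eDigit i := Cell 2 (Cst i).

Section Expressions.
Variable d : nat.

Let m := num_digits d.
Definition eGroup := eDigit m.
Definition eChoice := eDigit m.+1.
Definition eGroups := Add eK (Cst (tree_size d).+1).
Definition eRadix := Add (Add eN eGroups) (Cst 3).

Definition eWord :=
  eAnd (eEq (Cell 0 (Cst 2)) eN)
    (eAnd (eEq ePos (Add (Cell 0 (Cst 0)) (Cst 1))) (eLt (Cst 0) eN)).

Definition eLeaf q v (b : bool) :=
  if b then eAnd (eLt eGroup eK) (eEq eChoice v)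
  else eOr (eLe eK (eDigit q)) (eAnd (eEq eGroup (eDigit q)) (eNeq eChoice v)).

(** The recursion is carried out when the program is written, so the size of the expression depends
    on [d] only. Lacking a conditional, the case distinction on the fan-in becomes two guarded
    disjuncts. *)
Fixpoint eClause f q v (b : bool) :=
  if f is f'.+1 then
    let q1 := q.+1 in let q2 := q.+1 + tree_size f' in
    eOr (eAnd (eEq (eTag v) (Cst 0)) (eLeaf q v b))
    (eOr (eAnd (eEq (eTag v) (Cst 1)) (eClause f' q1 (ePred v (Cst 0)) (~~ b)))
    (eOr (eAnd (eEq (eTag v) (Cst (if b then 2 else 3)))
           (eOr (eLe (eFanin v) (eDigit q))
           (eOr (eAnd (eEq (eDigit q) (Cst 0)) (eClause f' q1 (ePred v (Cst 0)) b))
                (eAnd (eLt (Cst 0) (eDigit q)) (eClause f' q2 (ePred v (eDigit q)) b)))))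
         (eAnd (eEq (eTag v) (Cst (if b then 3 else 2)))
           (eOr (eAnd (eLe (eFanin v) (Cst 2))
             (eOr (eClause f' q1 (ePred v (Cst 0)) b)
                  (eAnd (eLt (Cst 1) (eFanin v)) (eClause f' q2 (ePred v (Cst 1)) b))))
           (eAnd (eLt (Cst 2) (eFanin v))
             (eOr (eLe (eFanin v) (eDigit q))
             (eOr (eAnd (eEq eGroup (Add eK (Cst q)))
                        (eAnd (eLt eChoice (eFanin v)) (eNeq eChoice (eDigit q))))
                  (eClause f' q1 (ePred v (eDigit q)) b))))))))
  else eLeaf q v b.

Fixpoint eWalk f i r v :=
  if f is f'.+1 then
    eOr (eLe (eFanin v) (eDigit i))
    (eOr (eAnd (eLe (eFanin v) (Cst 2)) (eWalk f' i.+1 r (ePred v (eDigit i))))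
         (eAnd (eLt (Cst 2) (eFanin v))
           (if r is r'.+1 then eWalk f' i.+1 r' (ePred v (eDigit i)) else Cst false)))
  else eEq (eFanin v) (Cst 0).

Definition eWfAt j i i' :=
  eOr (eLe eN j)
    (eAnd (eLe (eTag j) (Cst 3)) (eAnd (eLe (eFanin j) eN)
    (eAnd (eOr (eNeq (eTag j) (Cst 0)) (eEq (eFanin j) (Cst 0)))
    (eAnd (eOr (eNeq (eTag j) (Cst 1)) (eEq (eFanin j) (Cst 1)))
    (eAnd (eOr (eEq (eTag j) (Cst 0)) (eLt (Cst 0) (eFanin j)))
    (eAnd (eOr (eLe (eFanin j) i) (eLt (ePred j i) j))
      (eOr (eLe i' i) (eOr (eLe (eFanin j) i') (eNeq (ePred j i) (ePred j i')))))))))).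

Definition eCovers :=
  eAnd eWord (eAnd (eWfAt (eDigit 1) (eDigit 2) (eDigit 3))
  (eAnd (eWalk d 1 1 eOut)
    (eOr (eAnd (eEq (eDigit 0) (Cst 0)) (eClause d 1 eOut true))
    (eOr (eAnd (eEq (eDigit 0) (Cst 1)) (eOr (eLe eGroups (eDigit 1))
           (eAnd (eEq eGroup (eDigit 1)) (eAnd (eLt eChoice eN)
             (eOr (eLe eK eGroup) (eEq (eTag eChoice) (Cst 0)))))))
    (eOr (eAnd (eEq (eDigit 0) (Cst 2))
           (eOr (eLe eK (eDigit 2)) (eOr (eLe (eDigit 2) (eDigit 1))
             (eAnd (eOr (eEq eGroup (eDigit 1)) (eEq eGroup (eDigit 2)))
                   (eNeq eChoice (eDigit 3))))))
         (eLt (Cst 2) (eDigit 0))))))).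

Variables (k n : nat) (x : seq nat) (P : nat -> nat).
Let w := k :: x.

Record reads (s : state) : Prop := {
  reads_input : forall i, s 0 i = cell w i;
  reads_gates : forall i, s 1 i = P i;
  reads_size : s 3 0 = n;
  reads_end : s 3 1 = gate_pos w n }.

Section Value.
Variable s : state.
Hypothesis rs : reads s.
Let y := s 2.
Let g := s 2 m.
Let c := s 2 m.+1.
Let tg := tag_of w P.
Let ln := fanin_of w P.
Let pr := pred_of w P.

Lemma value_tag v : value s (eTag v) = tg (value s v).
Proof. by rewrite /= (reads_gates rs) (reads_input rs). Qed.

Lemma value_fanin v : value s (eFanin v) = ln (value s v).
Proof. by rewrite /= (reads_gates rs) (reads_input rs). Qed.

Lemma value_pred v i : value s (ePred v i) = pr (value s v) (value s i).
Proof. by rewrite /= (reads_gates rs) (reads_input rs). Qed.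

Lemma value_k : value s eK = k.
Proof. by rewrite /= (reads_input rs). Qed.

Lemma value_n : value s eN = n.
Proof. exact: reads_size rs. Qed.

Lemma value_out : value s eOut = n.-1.
Proof. by rewrite -[value s eOut]/(value s eN - 1) value_n subn1. Qed.

Lemma value_groups : value s eGroups = num_groups d k.
Proof. by rewrite -[LHS]/(value s eK + _) value_k. Qed.

Lemma value_radix : value s eRadix = radix d k n.
Proof. by rewrite -[LHS]/(value s eN + value s eGroups + 3) value_n value_groups. Qed.

Let value_cst i : value s (Cst i) = i. Proof. by []. Qed.
Let value_add e f : value s (Add e f) = value s e + value s f. Proof. by []. Qed.
Let value_digit i : value s (eDigit i) = y i. Proof. by []. Qed.
Let value_group : value s eGroup = g. Proof. by []. Qed.
Let value_choice : value s eChoice = c. Proof. by []. Qed.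

Let valueE := (value_digit, value_group, value_choice, value_cst, value_add, value_tag,
  value_fanin, value_pred, value_k, value_n, value_out, value_groups).

Lemma holds_word : holds s eWord = wf_word w n.
Proof. by rewrite /eWord !holdsE value_n /= !(reads_input rs) (reads_end rs) addn1. Qed.

Lemma holds_leaf q v b : holds s (eLeaf q v b) = leaf_clause k y g c q (value s v) b.
Proof. by case: b; rewrite /= !holdsE !valueE. Qed.

Lemma holds_clause f q v b :
  holds s (eClause f q v b) = clause tg ln pr k y g c f q (value s v) b.
Proof.
elim: f q v b => [|f IH] q v b; first exact: holds_leaf.
rewrite [eClause _ _ _ _]/= !holdsE !IH holds_leaf !valueE clauseS.
by case: (leqP (ln (value s v)) 2); rewrite /= ?orbF.
Qed.

Lemma holds_walk f i r v :
  holds s (eWalk f i r v) = okwalk ln pr y f i r (value s v).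
Proof.
elim: f i r v => [|f IH] i r v; rewrite /= !holdsE !valueE // IH !valueE.
by case: r => [|r]; rewrite ?IH ?valueE //= -[Cst 0]/(Cst false) holdsE.
Qed.

Lemma holds_wf_at i j l :
  holds s (eWfAt i j l) = wf_at tg ln pr n (value s i) (value s j) (value s l).
Proof. by rewrite /eWfAt !holdsE !valueE. Qed.

Lemma holds_covers : holds s eCovers = covers d k n tg ln pr (wf_word w n) y g c.
Proof.
rewrite /eCovers holds_and holds_word holds_and holds_wf_at holds_and holds_walk.
by rewrite !holdsE holds_clause !valueE.
Qed.
End Value.
End Expressions.

(** * The program of the reduction *)

(** The loop counters, in bank 2 from cell [i] on, are themselves the digits of the current vector,
    so no index has to be decoded. *)
Fixpoint nest (i m : nat) (e : expr) (body : prog) : prog :=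
  if m is m'.+1 then For 2 i e (nest i.+1 m' e body) else body.

Lemma nth_vectsS B m x t : x < B -> t < B ^ m ->
  nth [::] (vects B m.+1) (x * B ^ m + t) = x :: nth [::] (vects B m) t.
Proof.
move=> lt_x lt_t; rewrite [vects _ _]/=.
suff H a N z : z < N ->
    nth [::] [seq z' :: v | z' <- iota a N, v <- vects B m] (z * B ^ m + t) =
    (a + z) :: nth [::] (vects B m) t by exact: H.
elim: N a z => // N IH a z lt_z; rewrite /= nth_cat size_map size_vects.
case: z lt_z => [|z] lt_z; first by rewrite lt_t (nth_map [::]) ?size_vects ?addn0.
by rewrite ltnNge mulSn -addnA leq_addr /= addKn IH // addSnnS.
Qed.

(** Writing budgets as [z - 2], one loop turns [z] into at most [B * z + 4], and this is at most
    [(B + 2) * z] as soon as [z] is at least 2. *)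
Lemma wp_nest i m e body tb B (I : nat -> state -> Prop) s :
  (forall t s, I t s -> value s e = B) ->
  (forall t s j v, i <= j < i + m -> I t s -> I t (update s 2 j v)) ->
  (forall t s, t < B ^ m ->
     (forall r, r < m -> s 2 (i + r) = nth 0 (nth [::] (vects B m) t) r) -> I t s ->
     wp tb body s (fun s' => I t.+1 s' /\ forall r, r < m -> s' 2 (i + r) = s 2 (i + r))) ->
  I 0 s ->
  wp ((B + 2) ^ m * (tb + 2) - 2) (nest i m e body) s (I (B ^ m)).
Proof.
elim: m i I s => [|m IH] i I s bound upd step I0.
  rewrite !expn0 mul1n addnK; apply: wp_weaken (step 0 s _ _ I0) => //.
  by move=> s' [].
have Z : 2 <= (B + 2) ^ m * (tb + 2).
  have : 0 < (B + 2) ^ m by rewrite expn_gt0 addn2.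
  by nia.
apply: (@wp_weaken (B * ((B + 2) ^ m * (tb + 2) - 2).+2 + 2) _ _ _
  (fun s' => s' 2 i = B /\ I (B * B ^ m) s')); [|by rewrite expnS => s' []|].
  by rewrite expnS -mulnA mulnDl; move: ((B + 2) ^ m * (tb + 2)) Z => z Z; nia.
apply: (wp_for (I := fun j s => I (j * B ^ m) s)) => [j s' _ _ /bound //|j s' lt_j si Ij|].
  pose J t s := I (j * B ^ m + t) s /\ s 2 i = j.
  apply: wp_weaken (IH i.+1 J s' _ _ _ _) => //.
  - by move=> s1 [I1 s1i]; split=> //; rewrite mulSn addnC; apply: upd => //; lia.
  - by move=> t s1 [I1 _]; apply: bound I1.
  - move=> t s1 l v /andP[il lm] [I1 s1i]; split; first by apply: upd => //; lia.
    by rewrite updateE (ltn_eqF il) andbF.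
  - move=> t s1 lt_t digits [I1 s1i].
    have lt_jt : j * B ^ m + t < B ^ m.+1.
      by rewrite expnS; move: lt_j lt_t; set M := B ^ m; nia.
    have digits' r : r < m.+1 -> s1 2 (i + r) = nth 0 (nth [::] (vects B m.+1) (j * B ^ m + t)) r.
      by rewrite nth_vectsS //; case: r => [|r] lt_r; rewrite ?addn0 // -addSnnS digits.
    apply: wp_weaken (step _ _ lt_jt digits' I1) => // s2 [I2 frame]; split.
      by split; [rewrite addnS | rewrite -[i]addn0 frame // addn0].
    by move=> r lt_r; rewrite addSnnS frame.
  - by split; rewrite ?addn0.
by rewrite mul0n; apply: upd => //; lia.
Qed.

(** Output is buffered in bank 4, since [eCovers] goes on reading the input in bank 0. *)
Definition push (e : expr) : prog :=
  Seq (Assign 4 (Cell 3 (Cst 2)) e)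
      (Assign 3 (Cst 2) (Add (Cell 3 (Cst 2)) (Cst 1))).

Definition parse : prog :=
  Seq (Assign 3 (Cst 1) (Cst 3))
    (While (eLe ePos (Cell 0 (Cst 0)))
      (Seq (Assign 1 eN ePos)
      (Seq (Assign 3 (Cst 0) (Add eN (Cst 1)))
           (Assign 3 (Cst 1) (Add (Add ePos (Cst 2)) (Cell 0 (Add ePos (Cst 1)))))))).

Section Parse.
Variables (k : nat) (x : seq nat).
Let w := k :: x.

Definition parsing (n : nat) (s : state) : Prop :=
  [/\ forall i, s 0 i = cell w i, forall j, j < n -> s 1 j = gate_pos w j,
      forall j, j < n -> gate_pos w j <= size w,
      s 3 0 = n /\ s 3 1 = gate_pos w n
    & forall b i, 1 < b -> (b != 3) || (1 < i) -> s b i = 0].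

(** Every gate takes at least two cells, so fewer than [size w] gates start inside the word,
    whatever it contains. *)
Lemma wp_parse :
  wp (4 * size w + 10) parse (init w) (fun s => exists n,
    [/\ parsed w n (s 1), reads k n x (s 1) s
      & forall b i, 1 < b -> (b != 3) || (1 < i) -> s b i = 0]).
Proof.
pose I r s := exists2 n, r = size w - n & parsing n s.
rewrite (_ : 4 * size w + 10 = 1 + (4 * size w + 9)); last by lia.
apply/wp_seq/wp_assign => /=.
apply: wp_weaken (@wp_while I _ _ 3 (size w) _ _ _ _ _).
- by rewrite mulnC -addn1 leq_add2l.
- by move=> s'; exact.
- move=> r s [n -> [s0 s1 le_pos [s30 s31] rest]].
  rewrite -[_ != 0]/(holds s (eLe _ _)) !holdsE /= s0 s31 => le_n.
  have {}le_n : gate_pos w n <= size w := le_n.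
  have lt_n : n < size w by have := gate_pos_ge w n; lia.
  exists (size w - n.+1); first by rewrite subnSK.
  apply/(@wp_seq 1 2)/wp_assign/(@wp_seq 1 1)/wp_assign/wp_assign => /=.
  exists n.+1 => //; rewrite /parsing !updateE /= s30 s31 s0 addn1.
  split=> // [j|j|b i b1 bi].
  - rewrite !updateE /= ltnS leq_eqVlt => /orP[/eqP->|lt_j]; first by rewrite eqxx.
    by rewrite ltn_eqF // s1.
  - by rewrite ltnS leq_eqVlt => /orP[/eqP->|/le_pos].
  - rewrite !updateE; case: b b1 bi => [|[|b]] //= b1 bi; rewrite rest //.
    by case: b bi {b1} => [|[|b]] //=; case: i => [|[|i]].
- move=> r s [n _ [s0 s1 le_pos [s30 s31] rest]].
  move/eqP; rewrite -[_ == 0]negbK -[~~ (_ == 0)]/(holds s (eLe _ _)) !holdsE /=.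
  rewrite s0 s31 -ltnNge => gt_n.
  by exists n; split=> //; split=> // j lt_j; rewrite s1.
- exists 0; first by rewrite subn0.
  split=> //= b i b1 bi; rewrite updateE /init.
  by case: b b1 bi => [|[|[|[|b]]]] //=; case: i => [|[|i]].
Qed.
End Parse.

(** Further registers in bank 3: the buffer length (2), the ends of the current edge (3 and 4), the
    numbers of edges (5) and of vertices (6), and a loop counter (7). *)
Definition eScalar i := Cell 3 (Cst i).

Section Program.
Variable d : nat.
Let m := num_digits d.

Definition emit_edge : prog :=
  If (eCovers d)
    (Seq (push (eScalar 3)) (Seq (push (eScalar 4)) (Seq (push (Cst 1)) (Seq (push (Cst 1))
      (Assign 3 (Cst 5) (Add (eScalar 5) (Cst 1)))))))
    Skip.

Definition emit_row : prog :=
  Seq (Assign 3 (Cst 4) (Cst 0))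
  (Seq (nest m 2 (eRadix d) (Seq emit_edge (Assign 3 (Cst 4) (Add (eScalar 4) (Cst 1)))))
       (Assign 3 (Cst 3) (Add (eScalar 3) (Cst 1)))).

(** The header contains the number of edges, which is known only now. Cell 1 still holds [k] when
    [eGroups] is evaluated. *)
Definition write_output : prog :=
  Seq (For 3 7 (eScalar 2) (Assign 0 (Add (Cst 5) (eScalar 7)) (Cell 4 (eScalar 7))))
  (Seq (Assign 0 (Cst 0) (Add (Cst 4) (eScalar 2)))
  (Seq (Assign 0 (Cst 1) (eGroups d))
  (Seq (Assign 0 (Cst 2) (Cst 2))
  (Seq (Assign 0 (Cst 3) (eScalar 6))
       (Assign 0 (Cst 4) (eScalar 5)))))).

(** The numbers [B ^ 2] and [B ^ 2 + B ^ m] are read off as lengths of the supply list. Its entries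
    0 and 2 are the codes of [None] and [Some 1]. *)
Definition reduction : prog :=
  Seq parse
  (Seq (nest m 2 (eRadix d) (push (Cst 0)))
  (Seq (Assign 3 (Cst 3) (eScalar 2))
  (Seq (nest 0 m (eRadix d) (push (Cst 2)))
  (Seq (Assign 3 (Cst 6) (eScalar 2))
  (Seq (nest 0 m (eRadix d) emit_row)
       write_output))))).

Variables (k n : nat) (x : seq nat) (P : nat -> nat).
Let w := k :: x.
Let B := radix d k n.
Let rel := instance_rel d k n (tag_of w P) (fanin_of w P) (pred_of w P) (wf_word w n).

(* l is the output so far, apart from a header of four numbers. *)
Record env (l : seq nat) (j u e o : nat) (s : state) : Prop := {
  env_reads : reads k n x P s;
  env_size : s 3 2 = size l;
  env_out : forall i, i < size l -> s 4 i = nth 0 l i;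
  env_elem : s 3 3 = j;
  env_set : s 3 4 = u;
  env_edges : s 3 5 = e;
  env_order : s 3 6 = o }.

Lemma env_update l j u e o s i v : env l j u e o s ->
  [/\ env l j u e o (update s 2 i v), env l v u e o (update s 3 3 v),
      env l j v e o (update s 3 4 v), env l j u v o (update s 3 5 v)
    & env l j u e v (update s 3 6 v)].
Proof. by case=> -[? ? ? ?] *; split; split=> //; split. Qed.

Lemma env_radix l j u e o s : env l j u e o s -> value s (eRadix d) = B.
Proof. by move=> [rs _ _ _ _ _ _]; apply: value_radix rs. Qed.

Lemma wp_push ex l j u e o s (Q : state -> Prop) : env l j u e o s ->
  (forall s', env (rcons l (value s ex)) j u e o s' -> s' 2 =1 s 2 -> Q s') ->
  wp 2 (push ex) s Q.
Proof.
move=> [[r1 r2 r3 r4] h2 h4 h5 h6 h7 h8] H.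
apply/(@wp_seq 1 1)/wp_assign/wp_assign/H => //.
split=> //=; first by rewrite !updateE /= h2 size_rcons addn1.
move=> i; rewrite size_rcons ltnS nth_rcons !updateE /= h2 => le_i.
by case: ltngtP le_i => // lt_i _; rewrite h4.
Qed.

Lemma wp_zeros s : env [::] 0 0 0 0 s ->
  wp ((B + 2) ^ 2 * 4 - 2) (nest m 2 (eRadix d) (push (Cst 0))) s
    (env (nseq (B ^ 2) 0) 0 0 0 0).
Proof.
move=> e0; apply: (@wp_nest _ _ _ _ 2 B (fun t => env (nseq t 0) 0 0 0 0)) => //.
- by move=> t s' /env_radix.
- by move=> t s' i v _ /(env_update i v)[].
- move=> t s' _ _ es; apply: (wp_push es) => s2 es2 s2_2; split=> //.
  by move: es2; rewrite -cats1 -[[:: value _ _]]/(nseq 1 0) -nseqD addn1.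
Qed.

Definition supplies (t : nat) : seq nat := nseq (B ^ 2) 0 ++ nseq t 2.

Lemma wp_supplies s : env (supplies 0) (B ^ 2) 0 0 0 s ->
  wp ((B + 2) ^ m * 4 - 2) (nest 0 m (eRadix d) (push (Cst 2))) s
    (env (supplies (B ^ m)) (B ^ 2) 0 0 0).
Proof.
move=> e0; apply: (@wp_nest _ _ _ _ 2 B (fun t => env (supplies t) (B ^ 2) 0 0 0)) => //.
- by move=> t s' /env_radix.
- by move=> t s' i v _ /(env_update i v)[].
- move=> t s' _ _ es; apply: (wp_push es) => s2 es2 s2_2; split=> //.
  move: es2; rewrite /supplies -cats1 -catA.
  by rewrite -[[:: value _ _]]/(nseq 1 2) -nseqD addn1.
Qed.

Definition row (j u : nat) : seq edge :=
  [seq Edge (B ^ 2 + j) u' 1 1 | u' <- [seq u' <- iota 0 u | rel j u']].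

Definition written (es : seq edge) : seq nat :=
  supplies (B ^ m) ++ flatten (map encode_edge es).

Lemma rowS j u : row j u.+1 = row j u ++ (if rel j u then [:: Edge (B ^ 2 + j) u 1 1] else [::]).
Proof.
rewrite /row -[u.+1]addn1 iotaD filter_cat map_cat /= add0n.
by case: ifP.
Qed.

Lemma cover_edgesS j : cover_edges (B ^ 2) j.+1 rel = cover_edges (B ^ 2) j rel ++ row j (B ^ 2).
Proof. by rewrite /cover_edges -[j.+1]addn1 iotaD map_cat flatten_cat /= cats0 add0n. Qed.

Lemma wp_emit_edge es j u o s : env (written es) (B ^ 2 + j) u (size es) o s ->
  holds s (eCovers d) = rel j u ->
  wp 11 (Seq emit_edge (Assign 3 (Cst 4) (Add (eScalar 4) (Cst 1)))) s (fun s' =>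
    env (written (es ++ (if rel j u then [:: Edge (B ^ 2 + j) u 1 1] else [::])))
      (B ^ 2 + j) u.+1 (size (es ++ (if rel j u then [:: Edge (B ^ 2 + j) u 1 1] else [::]))) o s'
    /\ s' 2 =1 s 2).
Proof.
move=> es0 holdsE; apply: (@wp_seq 10 1); apply: wp_if => [|cov0].
  rewrite -[_ != 0]/(holds s _) holdsE => ->.
  apply: (@wp_seq 2 7); apply: (wp_push es0) => s1 es1 s1_2.
  apply: (@wp_seq 2 5); apply: (wp_push es1) => s2 es2 s2_2.
  apply: (@wp_seq 2 3); apply: (wp_push es2) => s3 es3 s3_2.
  apply: (@wp_seq 2 1); apply: (wp_push es3) => s4 es4 s4_2.
  apply: wp_assign; apply: wp_assign.
  have [_ _ _ es5 _] := env_update 0 (value s4 (Add (eScalar 5) (Cst 1))) es4.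
  set s5 := update _ _ _ _ in es5 *.
  have [_ _ es6 _ _] := env_update 0 (value s5 (Add (eScalar 4) (Cst 1))) es5.
  split; last by move=> i; rewrite /s5 !updateE /= s4_2 s3_2 s2_2 s1_2.
  move: es6; rewrite /= (env_set es5) (env_edges es4) (env_elem es0) (env_set es1).
  rewrite size_cat /= !addn1 /written map_cat flatten_cat catA.
  by rewrite -!cats1 -!catA.
have -> : rel j u = false by rewrite -holdsE /holds cov0.
rewrite cats0; apply: (@wp_weaken 1) => //; first by move=> s'; exact.
apply: wp_skip; apply: wp_assign.
have [_ _ es1 _ _] := env_update 0 (value s (Add (eScalar 4) (Cst 1))) es0.
by split=> //; move: es1; rewrite /= (env_set es0) addn1.
Qed.

Lemma wp_emit_row t s u : t < B ^ m ->
  (forall r, r < m -> s 2 r = nth 0 (nth [::] (vects B m) t) r) ->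
  env (written (cover_edges (B ^ 2) t rel)) (B ^ 2 + t) u
    (size (cover_edges (B ^ 2) t rel)) (B ^ 2 + B ^ m) s ->
  wp ((B + 2) ^ 2 * 13) emit_row s (fun s' => (exists u,
    env (written (cover_edges (B ^ 2) t.+1 rel)) (B ^ 2 + t.+1) u
      (size (cover_edges (B ^ 2) t.+1 rel)) (B ^ 2 + B ^ m) s') /\
    forall r, r < m -> s' 2 r = s 2 r).
Proof.
move=> lt_t digits es0.
have Z : 4 <= (B + 2) ^ 2 by rewrite -[4]/(2 ^ 2) leq_exp2r // leq_addl.
apply: (@wp_weaken (1 + (((B + 2) ^ 2 * (11 + 2) - 2) + 1)) _ _ _ _ _ _ (fun s' => id)); first by lia.
apply/wp_seq/wp_assign/wp_seq.
have [_ _ es1 _ _] := env_update 0 0 es0.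
pose I v s' := env (written (cover_edges (B ^ 2) t rel ++ row t v)) (B ^ 2 + t) v
    (size (cover_edges (B ^ 2) t rel ++ row t v)) (B ^ 2 + B ^ m) s' /\
  (forall r, r < m -> s' 2 r = s 2 r).
apply: wp_weaken (@wp_nest _ _ _ _ 11 B I _ _ _ _ _) => //.
- move=> s1 [es2 frame]; apply: wp_assign.
  have [_ es3 _ _ _] := env_update 0 (value s1 (Add (eScalar 3) (Cst 1))) es2.
  split=> // ; exists (B ^ 2); move: es3; rewrite -cover_edgesS /= (env_elem es2) addn1 addnS.
  exact.
- by move=> v s1 [/env_radix].
- move=> v s1 i c /andP[le_i _] [es2 frame]; split; first by have [] := env_update i c es2.
  by move=> r lt_r; rewrite updateE /= ltn_eqF ?frame // (leq_trans lt_r).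
- move=> v s1 lt_v digits' [es2 frame].
  have relE : holds s1 (eCovers d) = rel t v.
    rewrite (holds_covers d (env_reads es2)) /rel /instance_rel.
    rewrite -(digits' 0) // -(digits' 1) // addn0 addn1; apply: covers_ext => r lt_r.
    by rewrite frame // digits.
  apply: wp_weaken (wp_emit_edge es2 relE) => // s2 [es3 frame']; split.
    split; first by rewrite rowS catA.
    by move=> r lt_r; rewrite frame' frame.
  by move=> r _; rewrite frame'.
- by split; rewrite ?cats0 //.
Qed.

Lemma wp_emit_rows s : env (supplies (B ^ m)) (B ^ 2) 0 0 (B ^ 2 + B ^ m) s ->
  wp ((B + 2) ^ m * ((B + 2) ^ 2 * 13 + 2) - 2) (nest 0 m (eRadix d) emit_row) s
    (fun s' => exists j u, env (written (cover_edges (B ^ 2) (B ^ m) rel)) j u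
      (size (cover_edges (B ^ 2) (B ^ m) rel)) (B ^ 2 + B ^ m) s').
Proof.
move=> es0.
pose I t s' := exists u, env (written (cover_edges (B ^ 2) t rel)) (B ^ 2 + t) u
    (size (cover_edges (B ^ 2) t rel)) (B ^ 2 + B ^ m) s'.
apply: wp_weaken (@wp_nest _ _ _ _ ((B + 2) ^ 2 * 13) B I _ _ _ _ _) => //.
- by move=> s1 [u es1]; exists (B ^ 2 + B ^ m), u.
- by move=> t s1 [u /env_radix].
- by move=> t s1 i v _ [u es1]; exists u; have [] := env_update i v es1.
- by move=> t s1 lt_t digits [u es1]; apply: wp_emit_row es1.
- by exists 0; rewrite /written cats0 addn0.
Qed.

Lemma wp_write_output l j u e o s : env l j u e o s ->
  wp (size l * 3 + 7) write_output s (result [:: num_groups d k, 2, o, e & l]).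
Proof.
move=> es0.
apply: (@wp_weaken ((size l * 3 + 2) + (1 + (1 + (1 + (1 + 1))))) _ _ _ _ _ _ (fun s' => id)).
  by lia.
apply: wp_seq.
pose I t s' := [/\ s' 0 1 = k, forall i, i < t -> s' 0 (5 + i) = nth 0 l i,
  forall i, s' 4 i = s 4 i & [/\ s' 3 2 = size l, s' 3 5 = e & s' 3 6 = o]].
have [[r1 r2 r3 r4] h2 h4 h5 h6 h7 h8] := es0.
apply: wp_weaken (wp_for (I := I) (N := size l) (n := 1) _ _ _) => //.
- move=> s' [_ [k1 l1 _ [s1 s2 s3]]]; do 4![apply/(@wp_seq 1)/wp_assign]; apply: wp_assign.
  move=> [|[|[|[|[|i]]]]] /=; rewrite !updateE //= ?s1 ?s2 ?s3 ?k1 //.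
  by rewrite !ltnS => lt_i; rewrite -l1.
- by move=> t s' _ _ [_ _ _ []].
- move=> t s' lt_t s'7 [k1 l1 e1 [s1 s2 s3]]; apply: wp_assign; split=> //=.
  split=> //= i; rewrite !updateE /= s'7 eqn_add2l ltnS leq_eqVlt.
  by case: eqP => [-> _|_ /= /l1 //]; rewrite e1 h4.
- by split=> //=; rewrite updateE /= ?r1.
Qed.
End Program.

Section Reduction.
Variables (d k n : nat) (x : seq nat) (P : nat -> nat).
Let w := k :: x.
Let B := radix d k n.
Let m := num_digits d.

Definition reduced_network : network :=
  cover_network (B ^ 2) (B ^ m)
    (instance_rel d k n (tag_of w P) (fanin_of w P) (pred_of w P) (wf_word w n)).

Lemma reduced_network_correct (R : realType) directed : parsed w n P ->
  WCS 1 d x k <->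
  k_sink_location R directed (encode_network reduced_network 2) (num_groups d k).
Proof.
move=> parsedP; split=> [/(circuit_answers parsedP)[h hn ans]|].
  by apply/k_sink_cover; have [X [? ? ? ?]] := answers_cover hn ans; exists X.
case/k_sink_cover=> X [uniqX sizeX _ covX].
have [h hn ans] := cover_answers uniqX sizeX covX.
exact: answers_circuit parsedP h hn ans.
Qed.

Lemma encode_reduced_network : encode_network reduced_network 2 =
  [:: 2, B ^ 2 + B ^ m, size (edges reduced_network) & written d k n (edges reduced_network)].
Proof.
rewrite /encode_network cover_network_order /written /supplies /=.
by rewrite map_cat !map_nseq.
Qed.

Lemma size_cover_edges ns ne (r : nat -> nat -> bool) : size (cover_edges ns ne r) <= ne * ns.
Proof.
rewrite /cover_edges size_allpairs_dep -[X in _ <= X * _](size_iota 0 ne).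
elim: (iota 0 ne) => //= j s IH; rewrite mulSn; apply: leq_add => //.
by rewrite size_filter -[leqRHS](size_iota 0 ns) count_size.
Qed.

Lemma size_written es : size (written d k n es) = B ^ 2 + B ^ m + 4 * size es.
Proof.
rewrite /written /supplies !size_cat !size_nseq; congr (_ + _).
by elim: es => //= e es ->; rewrite mulnS.
Qed.
End Reduction.

Lemma reduction_computes d k x : exists n P, parsed (k :: x) n P /\
  exists2 t, computes (reduction d) (k :: x) t
      (num_groups d k :: encode_network (reduced_network d k n x P) 2)
    & t + size (encode_network (reduced_network d k n x P) 2) <=
      4 * size x + 100 * (radix d k n + 2) ^ (num_digits d + 2).
Proof.
set w := k :: x; set m := num_digits d.
have [t1 [s1 [ex1 le_t1 [n [parsedP reads1 zeros]]]]] := wp_parse k x.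
exists n, (s1 1); split=> //.
set N := reduced_network _ _ _ _ _; set B := radix d k n.
have env1 : env k n x (s1 1) [::] 0 0 0 0 s1 by split=> //; apply: zeros.
set T := (4 * size w + 10) + (((B + 2) ^ 2 * 4 - 2) + (1 + (((B + 2) ^ m * 4 - 2) + (1 +
  (((B + 2) ^ m * ((B + 2) ^ 2 * 13 + 2) - 2) +
   (size (written d k n (edges N)) * 3 + 7)))))).
have [t [s [ex le_t res]]] : wp T (reduction d) (init w)
    (result (num_groups d k :: encode_network N 2)).
  apply: wp_seq; exists t1, s1; split=> //.
  apply: wp_seq; apply: wp_weaken (wp_zeros d env1) => // s2 env2.
  apply/wp_seq/wp_assign/wp_seq.
  have [_ env3 _ _ _] := env_update 0 (value s2 (eScalar 2)) env2.
  move: env3; rewrite -[value s2 _]/(s2 3 2) (env_size env2) size_nseq => env3.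
  have env3' : env k n x (s1 1) (supplies d k n 0) (B ^ 2) 0 0 0 (update s2 3 3 (B ^ 2)).
    by rewrite /supplies cats0.
  apply: wp_weaken (wp_supplies env3') => // s4 env4.
  apply/wp_seq/wp_assign/wp_seq.
  have [_ _ _ _ env5] := env_update 0 (value s4 (eScalar 2)) env4.
  move: env5; rewrite -[value s4 _]/(s4 3 2) (env_size env4).
  rewrite [size _]size_cat !size_nseq => env5.
  apply: wp_weaken (wp_emit_rows env5) => // s6 [j [u env6]].
  by rewrite encode_reduced_network; apply: (wp_write_output d env6).
exists t; first by exists s.
rewrite encode_reduced_network /=.
apply: (@leq_trans (T + (size (written d k n (edges N))).+3)); first by rewrite leq_add2r.
rewrite /T size_written; have := size_cover_edges (B ^ 2) (B ^ m)
  (instance_rel d k n (tag_of w (s1 1)) (fanin_of w (s1 1)) (pred_of w (s1 1)) (wf_word w n)).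
rewrite -[cover_edges _ _ _]/(edges N) -/m -/B /w [size (_ :: _)]/=.
have leB i : B ^ i <= (B + 2) ^ i by case: i => // i; rewrite leq_exp2r // leq_addr.
have leZ i j : i <= j -> (B + 2) ^ i <= (B + 2) ^ j.
  by move=> le_ij; rewrite leq_pexp2l // addn2.
have := (leB 2, leB m, leZ 2 (m + 2) (leq_addl _ _), leZ m (m + 2) (leq_addr _ _)).
have : B ^ m * B ^ 2 <= (B + 2) ^ (m + 2) by rewrite -expnD; apply: leB.
(* Absorbs the additive constants; there are at least 5 digits. *)
have : 32 <= (B + 2) ^ (m + 2).
  apply: leq_trans (_ : 2 ^ 5 <= _) => //.
  apply: leq_trans (_ : (B + 2) ^ 5 <= _); first by rewrite leq_exp2r // leq_addl.
  by apply: leZ; rewrite /m /num_digits; have := tree_size_gt0 d; lia.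
have -> : (B + 2) ^ m * ((B + 2) ^ 2 * 13 + 2) = 13 * (B + 2) ^ (m + 2) + 2 * (B + 2) ^ m.
  by rewrite expnD; nia.
move: ((B + 2) ^ m) ((B + 2) ^ 2) ((B + 2) ^ (m + 2)) (B ^ m) (B ^ 2).
move=> a b c a' b' c32 h [[[h1 h2] h3] h4] h5.
move: (size (edges N)) (a' * b') h h5 => e p h h5.
lia.
Qed.

(** * The reduction *)

Lemma computable_mul c f : computable f -> computable (fun n => c * f n).
Proof.
move=> cf; elim: c => [|c IH]; first exact: computable_cst.
exact: computable_add cf IH.
Qed.

(* The running time does not depend on the sizes of the numbers in x, so that no
   bound on the numbers in the output of a preceding reduction is needed. *)
Lemma WCS_to_k_sink (R : realType) directed d k x : exists x' t,
  [/\ computes (reduction d) (k :: x) t (num_groups d k :: x'),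
      t + size x' <= 104 * ((k + (tree_size d + 7)) * (size x).+1) ^ (num_digits d + 2)
    & WCS 1 d x k <-> k_sink_location R directed x' (num_groups d k)].
Proof.
have [n [P [parsedP [t ex le_t]]]] := reduction_computes d k x.
exists (encode_network (reduced_network d k n x P) 2), t; split=> //; last exact: reduced_network_correct.
apply: leq_trans le_t _; have := parsed_lt parsedP; rewrite /= => le_n.
set Z := _ * (size x).+1.
have le_Z : radix d k n + 2 <= Z by rewrite /radix /num_groups /Z; nia.
have le_x : size x <= Z ^ (num_digits d + 2).
  apply: (@leq_trans (Z ^ 1)); first by rewrite expn1 /Z; nia.
  by rewrite leq_pexp2l // /Z; [nia | rewrite addn2].
have : (radix d k n + 2) ^ (num_digits d + 2) <= Z ^ (num_digits d + 2).
  by rewrite leq_exp2r // addn2.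
by lia.
Qed.

Theorem theorem2 (R : realType) (directed : bool) :
  W_hard 1 (k_sink_location R directed).
Proof.
move=> L [d [p [f [g [c [comp_f comp_g red]]]]]].
pose a := tree_size d + 7; pose e := num_digits d + 2.
(* The part of the bound that depends on [k]: [k1 + a] is at most [g k + a], and [size x1] is at
   most [f k] times a power of [S]. *)
pose U k := (g k + a) * (f k).+1.
(* The functions shown to be computable are closed under sums, constant multiples and powers of 2,
   so the bound is one power of 2: [9] pays for the constant factor, the rest for [U k ^ e], as a
   number is less than 2 to its power. *)
exists (compose p (reduction d)),
  (fun k => 2 ^ (9 + e * (g k + f k + (a + 1)))),
  (fun k => g k + (tree_size d).+1), (c * e).
split.
- apply: (computable_comp _ computable_exp2); apply: computable_add (computable_cst 9) _.
  apply: computable_mul; apply: computable_add (computable_cst _).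
  exact: computable_add.
- exact: computable_add (computable_cst _).
move=> x k; have [x1 [k1 [t1 [ex1 le1 le_k1 iff1]]]] := red x k.
have [x2 [t2 [ex2 le2 iff2]]] := WCS_to_k_sink R directed d k1 x1.
have [t le_t ex] := computes_compose ex1 ex2.
exists x2, (num_groups d k1), t; split=> //; first last.
- by rewrite iff1.
- by rewrite /num_groups leq_add2r.
rewrite -/a -/e in le2; rewrite /= in le_t; set S := (bitsize x).+1 in le1 *.
have e0 : 0 < e by rewrite /e addn2.
pose V := U k * S ^ c.
have S0 : 0 < S ^ c by rewrite expn_gt0.
have le_V1 : f k * S ^ c <= V by rewrite /V /U; nia.
have V0 : 0 < V by rewrite /V /U /a; nia.
have le_V2 : (k1 + a) * (size x1).+1 <= V.
  apply: leq_trans (_ : (g k + a) * ((f k).+1 * S ^ c) <= _); last by rewrite /V /U mulnA.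
  by apply: leq_mul; [rewrite leq_add2r | nia].
have le_Ve : V <= V ^ e by rewrite -{1}(expn1 V) leq_pexp2l.
have le_Z : ((k1 + a) * (size x1).+1) ^ e <= V ^ e by rewrite leq_exp2r.
(* Four copies of the bound [104 * V ^ e] for [t2] and [size x2], three of [V] for [t1] and
   [size x1], and the cost 16 of the copies and their headers. *)
apply: (@leq_trans (436 * V ^ e)); first by lia.
rewrite /V expnMn -expnM mulnA leq_mul2r; apply/orP; right.
rewrite expnD leq_mul // [e * _]mulnC expnM leq_exp2r // /U.
have -> : g k + f k + (a + 1) = (g k + a) + (f k).+1 by lia.
by rewrite expnD leq_mul // ltnW // ltn_expl.
Qed.
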